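(* Let $t\geq 3$. Then $K_t^+$ is $2$-nice. Consequently, letting $s:=|V(K_t^+)|=t+\binom{t}{2}$ (so that $|E(K_t^+)|=2\binom{t}{2}$), we have \[ f\left(n,2s,\binom{2s}{2}-2\binom{t}{2}+1\right)=\Omega\left(n^{1+\frac{1}{2t-3}}\right). \]
   Context: For positive integers $p,q$ with $1\le q\le\binom p2$, a $(p,q)$-coloring of $K_n$ is an edge-coloring of $K_n$ in which every $p$ vertices span a clique with at least $q$ distinct colors; $f(n,p,q)$ is the minimum number of colors in a $(p,q)$-coloring of $K_n$. $\mathrm{ex}(n,F)$ is the Turán number (maximum number of edges in an $n$-vertex graph with no copy of $F$). Asymptotics are in $n$ with all other parameters constant. For a bipartite graph $F$ and constants $r\ge 2$, $\alpha>0$, $F$ is called $(r,\alpha)$-nice if $\mathrm{ex}(n,F)=O(n^{2-\alpha})$ and \[ f\left(n,r|V(F)|,\binom{r|V(F)|}{2}-(r-1)|E(F)|+1\right)=\Omega\left(n^{\frac{\alpha r}{r-1}}\right). \] $F$ is called $r$-nice if $F$ is $(r,\alpha)$-nice for every $\alpha>0$ such that $\mathrm{ex}(n,F)=O(n^{2-\alpha})$. For $t\ge3$, $K_t^+$ denotes the subdivision of $K_t$ obtained by replacing each edge by a path with two edges. *)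

(* Defs.v *)
From HB Require Import structures.
From mathcomp Require Import all_boot all_order all_algebra.
From mathcomp Require Import boolp classical_sets reals topology normedtype.
From mathcomp Require Import landau sequences exp.

Set Implicit Arguments.
Unset Strict Implicit.
Unset Printing Implicit Defensive.

Import Order.TTheory GRing.Theory Num.Theory.
Import numFieldNormedType.Exports.

Definition clique_edges (T : finType) (A : {set T}) : {set {set T}} :=
  [set e : {set T} | (e \subset A) && (#|e| == 2)].

Record sgraph := SGraph {
  vertex :> finType;
  edges : {set {set vertex}};
  edges_simple : edges \subset clique_edges [set: vertex]
}.

Definition bipartite (F : sgraph) : Prop :=
  exists A : {set F}, forall e, e \in edges F -> #|e :&: A| = 1.

Section SubdividedClique.
Variable t : nat.

(* inl v is an original vertex of K_t, inr e the vertex subdividing edge e. *)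
Definition subdiv_vertex : finType :=
  ('I_t + {e : {set 'I_t} | #|e| == 2})%type.

Definition subdiv_edges : {set {set subdiv_vertex}} :=
  [set [set (inl ve.1 : subdiv_vertex); inr ve.2] |
     ve : 'I_t * {e : {set 'I_t} | #|e| == 2} & ve.1 \in val ve.2].

Lemma subdiv_edges_simple :
  subdiv_edges \subset clique_edges [set: subdiv_vertex].
Proof.
by apply/fintype.subsetP => _ /imsetP[ve _ ->]; rewrite inE finset.subsetT cards2.
Qed.

Definition subdivided_clique : sgraph := SGraph subdiv_edges_simple.

End SubdividedClique.

(* Copies are not required to be induced. *)
Definition contains_copy (T : finType) (E : {set {set T}}) (F : sgraph) : bool :=
  [exists g : {ffun F -> T},
     injectiveb g && [forall e in edges F, g @: e \in E]].

Definition turan (n : nat) (F : sgraph) : nat :=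
  \max_(E : {set {set 'I_n}} |
          (E \subset clique_edges [set: 'I_n]) && ~~ contains_copy E F) #|E|.

(* An edge-coloring of K_n is a map c on sets of vertices; only its values on
   the two-element sets are ever used. *)
Definition ncolors (T : finType) (c : {set T} -> nat) (A : {set T}) : nat :=
  size (undup [seq c e | e in clique_edges A]).

Definition pq_coloring (n p q : nat) (c : {set 'I_n} -> nat) : Prop :=
  forall A : {set 'I_n}, #|A| = p -> (q <= ncolors c A)%N.

Definition pq_colorable_with (n p q k : nat) : Prop :=
  exists2 c : {set 'I_n} -> nat,
    pq_coloring p q c & ncolors c [set: 'I_n] = k.

Lemma asbool_ex (P : nat -> Prop) : (exists k, P k) -> exists k, `[< P k >].
Proof. by case=> k Pk; exists k; apply/asboolP. Qed.

(* The default value 0 is only taken when no (p, q)-coloring of K_n exists,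
   which never happens in the range q <= 'C(p, 2). *)
Definition erdos_gyarfas (n p q : nat) : nat :=
  if pselect (exists k, pq_colorable_with n p q k) is left h
  then ex_minn (asbool_ex h) else 0.

Local Open Scope ring_scope.
Local Open Scope classical_set_scope.

Definition turan_bigO (R : realType) (F : sgraph) (alpha : R) : Prop :=
  (fun n : nat => (turan n F)%:R : R) =O_\oo (fun n : nat => n%:R `^ (2 - alpha)).

(* (r - 1)|E(F)| <= 'C(r|V(F)|, 2) for bipartite F, so the truncated
   subtraction in the third argument of erdos_gyarfas is exact. *)
Definition alpha_nice (R : realType) (r : nat) (alpha : R) (F : sgraph) : Prop :=
  [/\ bipartite F, (2 <= r)%N, 0 < alpha, turan_bigO F alpha &
    (fun n : nat =>
       (erdos_gyarfas n (r * #|F|)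
          ('C(r * #|F|, 2) - (r - 1) * #|edges F| + 1))%:R : R)
    =Omega_\oo (fun n : nat => n%:R `^ (alpha * r%:R / (r%:R - 1)))].

Definition nice (R : realType) (r : nat) (F : sgraph) : Prop :=
  [/\ bipartite F, (2 <= r)%N &
    forall alpha : R, 0 < alpha -> turan_bigO F alpha -> alpha_nice r alpha F].

(* Main.v *)
(** Let [F] be [K_t^+], let [c] be a coloring of [K_n] with [k] colors in which
    any [2 |F|] vertices see more than [binom (2 |F|) 2 - |E(F)|] colors, and join
    [(a, b)] to [(a', b')] in an auxiliary graph on [V * V] when [aa'] and [bb'] have
    the same color.  By Cauchy-Schwarz this graph has at least of the order of
    [n^4 / k] edges.  Color degrees of [c] are bounded, since a large monochromatic
    star has too few colors; hence a constant proportion of the auxiliary edges can be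
    kept in such a way that the neighbours of any vertex differ in the second
    coordinate.  A copy of [F] in what remains
    gives [|E(F)|] pairs of edges of equal color on at most [2 |F|] vertices, even
    when its coordinates are not all distinct: the branch vertices of [F] are pairwise
    at distance two, so distinct edges of [F] have distinct projections.  Hence
    [n^4 = O(k ex(n^2, F))], which is the niceness of [F].

    The exponent of the second claim comes from Janzer's bound
    [ex(n, K_t^+) = O(n^(3/2 - 1/(4t-6)))].  In an almost regular bipartite
    [K_t^+]-free graph the pairs of codegree at least [binom t 2] inside a neighbourhood
    span no [K_t], so every large set of vertices has a vertex with many light
    (positive, smaller codegree) neighbours in it; choosing branch vertices greedily
    along light pairs, away from the neighbours of common neighbours of earlier pairs,
    produces [K_t^+].  Almost regularity is obtained by maximising
    [e(A,B)^(2t-3) / (min(|A|,|B|)^(t-2) max(|A|,|B|)^(2t-3))]. *)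

Require Import Defs.
From HB Require Import structures.
From mathcomp Require Import all_boot all_order all_algebra.
From mathcomp Require Import zify ring lra.

Set Implicit Arguments.
Unset Strict Implicit.
Unset Printing Implicit Defensive.

Import Order.TTheory GRing.Theory Num.Theory.

Local Notation pair_of t := {e : {set 'I_t} | #|e| == 2}.

(** * Counting in finite sets *)

(** Cauchy-Schwarz against the constant function, by summing [2ab <= a^2 + b^2] over all pairs of
    indices. *)
Lemma sum_sqr_seq (I : Type) (r : seq I) (F : I -> nat) :
  (\sum_(i <- r) F i) ^ 2 <= size r * \sum_(i <- r) F i ^ 2.
Proof.
have e2 : (\sum_(i <- r) F i) ^ 2 = \sum_(i <- r) \sum_(j <- r) F i * F j.
  by rewrite expnS expn1 big_distrl /=; apply: eq_bigr => i _; rewrite big_distrr.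
have s1 : \sum_(i <- r) \sum_(j <- r) F i ^ 2 = size r * \sum_(i <- r) F i ^ 2.
  rewrite big_distrr /=; apply: eq_bigr => i _.
  by rewrite big_const_seq count_predT iter_addn_0 mulnC.
rewrite e2 -(leq_pmul2l (isT : 0 < 2)) -s1.
rewrite [X in _ <= X]mul2n -addnn [X in _ <= _ + X]exchange_big /= -big_split /=.
rewrite big_distrr /=; apply: leq_sum => i _.
rewrite -big_split big_distrr /=; apply: leq_sum => j _.
exact: nat_Cauchy.
Qed.

Lemma sum_sqr_set (T : finType) (A : {set T}) (F : T -> nat) :
  (\sum_(i in A) F i) ^ 2 <= #|A| * \sum_(i in A) F i ^ 2.
Proof. by rewrite -!big_enum /= cardE; apply: sum_sqr_seq. Qed.

Lemma card_setId_sum (T : finType) (A : {set T}) (P : pred T) :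
  #|[set x in A | P x]| = \sum_(x in A) P x.
Proof.
rewrite -sum1_card big_mkcond [RHS]big_mkcond /=; apply: eq_bigr => x _.
by rewrite inE; case: (x \in A); case: (P x).
Qed.

Lemma exists_max_sum (T : finType) (A : {set T}) (F : T -> nat) :
  A != set0 -> exists2 x, x \in A & \sum_(i in A) F i <= #|A| * F x.
Proof.
case/set0Pn => x0 x0A; case: (@arg_maxnP _ x0 (fun x => x \in A) F x0A) => x xA xmax.
exists x => //; rewrite -sum_nat_const; exact: leq_sum.
Qed.

(** Turán's theorem for the complement, diagonal pairs included. Induction on [k]: outside the
    neighbourhood [N] of a vertex of maximal degree every vertex has at least [#|S| - #|N|]
    non-neighbours, while [N] spans no clique of the next smaller size. *)
Lemma card_nonadjacent_clique_free (T : finType) (H : rel T) k (S : {set T}) :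
  symmetric H -> irreflexive H ->
  (forall K : {set T}, K \subset S -> #|K| = k.+1 ->
     ~ {in K &, forall x y, x != y -> H x y}) ->
  #|S| ^ 2 <= k * \sum_(x in S) #|[set y in S | ~~ H x y]|.
Proof.
move=> Hs Hi; elim: k S => [|k IH] S noK.
  have [->|/set0Pn[x xS]] := eqVneq S set0; first by rewrite cards0.
  exfalso; apply: (noK [set x]); rewrite ?sub1set ?cards1 //.
  by move=> y z /set1P-> /set1P->; rewrite eqxx.
have [->|/set0Pn[x0 x0S]] := eqVneq S set0; first by rewrite cards0.
case: (@arg_maxnP _ x0 (fun x => x \in S) (fun x => #|[set y in S | H x y]|) x0S) => v vS.
set N := [set y in S | H v y] => vmax.
have NS : N \subset S by apply/subsetP => y; rewrite inE => /andP[].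
have IHN := IH N; set X := \sum_(x in N) _ in IHN.
have {}IHN : #|N| ^ 2 <= k * X.
  apply: IHN => K KN Kc Kcl; apply: (noK (v |: K)).
  - by rewrite subUset sub1set vS (subset_trans KN).
  - rewrite cardsU1 Kc; case: (boolP (v \in K)) => // /(subsetP KN).
    by rewrite inE Hi andbF.
  - move=> x y /setU1P[->|xK] /setU1P[->|yK].
    + by rewrite eqxx.
    + by move/(subsetP KN): yK; rewrite inE => /andP[].
    + by move/(subsetP KN): xK; rewrite inE Hs => /andP[].
    + exact: Kcl.
have splitS : (#|S| - #|N|) ^ 2 + X <= \sum_(x in S) #|[set y in S | ~~ H x y]|.
  rewrite (big_setID N) /= (setIidPr NS) addnC leq_add //.
    by apply: leq_sum => x xN; apply/subset_leq_card/subsetP => y;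
      rewrite !inE => /andP[/andP[-> _] ->].
  rewrite expnS expn1 -{1}(cardsDS NS) -sum_nat_const.
  apply: leq_sum => x /setDP[xS _].
  have := vmax x xS; rewrite leq_subLR => le.
  apply: leq_trans (leq_add le (leqnn _)).
  rewrite -cardsUI; apply: leq_trans (leq_addr _ _).
  by apply/subset_leq_card/subsetP => y yS; rewrite !inE yS /= orbN.
have cNS := subset_leq_card NS.
(* With [y = #|S| - #|N|] and [d = #|N|] it remains to derive [(y + d)^2 <= (k + 1) (y^2 + X)] from
   [d^2 <= k X]. *)
apply: leq_trans (leq_mul (leqnn _) splitS).
rewrite -{1}(subnK cNS); set y := _ - _; set d := #|N| in IHN *.
move: IHN; clearbody X y d; clear; rewrite !expnS !expn0 !muln1.
case: k => [|k] h; first by have ->: d = 0; nia.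
have : 2 * (y * d) <= k.+1 * (y * y) + X.
  rewrite -(leq_pmul2l (ltn0Sn k)).
  have := nat_Cauchy (k.+1 * y) d; rewrite !expnS !expn0 !muln1 => cs.
  rewrite (_ : k.+1 * (2 * (y * d)) = 2 * (k.+1 * y * d)); last by ring.
  apply: leq_trans cs _.
  rewrite (_ : k.+1 * (k.+1 * (y * y) + X) = k.+1 * y * (k.+1 * y) + k.+1 * X).
    by rewrite leq_add2l.
  by ring.
rewrite !mulnDl !mulnDr; lia.
Qed.

Lemma distinct_representatives (I W : finType) (S : I -> {set W}) (w0 : W) :
  (forall e, #|I| <= #|S e|) ->
  exists2 y : I -> W, injective y & forall e, y e \in S e.
Proof.
move=> cS.
suff [y yin ymem] : exists2 y : I -> W, {in enum I &, injective y} &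
    {in enum I, forall e, y e \in S e}.
  by exists y => [e e' |e]; [apply: yin | apply: ymem]; rewrite mem_enum.
have : {in enum I, forall e, size (enum I) <= #|S e|}.
  by move=> e _; rewrite -cardE.
elim: (enum I) (enum_uniq I) => [|a s IH] /= => [_ _|/andP[as_ us] cs].
  by exists (fun=> w0).
have [|y yin ymem] := IH us.
  by move=> e es; apply/ltnW/cs; rewrite inE es orbT.
have : 0 < #|S a :\: [set y e | e in s]|.
  rewrite cardsD subn_gt0; apply: leq_ltn_trans (cs a (mem_head _ _)).
  apply: leq_trans (subset_leq_card (subsetIr _ _)) _.
  exact: leq_trans (leq_imset_card _ _) (card_size _).
case/card_gt0P => w /setDP[wS wy].
exists (fun e => if e == a then w else y e).
- move=> e e'; rewrite !inE.
  case: eqP => [->|_] /=; case: eqP => [->|_] //= es e's.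
  + by move=> we; case/negP: wy; rewrite we imset_f.
  + by move=> we; case/negP: wy; rewrite -we imset_f.
  + exact: yin.
- move=> e; rewrite inE; case: eqP => [->|_] //= es; exact: ymem.
Qed.

(** * Light pairs and the greedy choice of branch vertices *)

Section Bipartite.
Variables (U W : finType) (adj : U -> W -> bool) (t : nat).

(** Branch vertices are confined to [U] and subdividing ones to [W], so the two orientations of a
    bipartite graph are separate instances. *)
Definition has_subdivision : Prop :=
  exists (x : 'I_t -> U) (y : pair_of t -> W),
    [/\ injective x, injective y & forall i (e : pair_of t), i \in val e -> adj (x i) (y e)].

Definition edge_count (A : {set U}) (B : {set W}) : nat :=
  \sum_(u in A) #|[set w in B | adj u w]|.

Definition codegree (B : {set W}) (u v : U) : nat :=
  #|[set w in B | adj u w && adj v w]|.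

(** Positivity lets the pair be joined through [B]; the upper bound keeps the number of vertices
    forbidden in the greedy choice small. *)
Definition light (B : {set W}) (u v : U) : bool :=
  [&& u != v, 0 < codegree B u v & codegree B u v < 'C(t, 2)].

Lemma edge_countC A B :
  edge_count A B = \sum_(w in B) #|[set u in A | adj u w]|.
Proof.
rewrite /edge_count; under eq_bigr do rewrite card_setId_sum.
by rewrite exchange_big /=; under [RHS]eq_bigr do rewrite card_setId_sum.
Qed.

Lemma codegreeC B u v : codegree B u v = codegree B v u.
Proof. by rewrite /codegree; apply: eq_card => w; rewrite !inE (andbC (adj u w)). Qed.

Lemma card_pairs_ord : #|{: pair_of t}| = 'C(t, 2).
Proof.
have := cards_draws [set: 'I_t] 2; rewrite cardsT card_ord => <-; rewrite card_sig.
by apply: eq_card => A; rewrite !inE subsetT.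
Qed.

Lemma heavy_clique_subdivision (B : {set W}) (K : {set U}) :
  1 < t -> #|K| = t ->
  {in K &, forall u v, u != v -> 'C(t, 2) <= codegree B u v} ->
  has_subdivision.
Proof.
move=> t1 Kt heavy.
pose x (i : 'I_t) : U := enum_val (cast_ord (esym Kt) i).
have xK i : x i \in K by apply: enum_valP.
have xinj : injective x by move=> i j /enum_val_inj/cast_ord_inj.
pose S (e : pair_of t) :=
  [set w in B | [forall i in val e, adj (x i) w]].
have cS e : #|{: pair_of t}| <= #|S e|.
  rewrite card_pairs_ord; have /cards2P[i [j [ij eij]]] : #|val e| == 2 := valP e.
  have hv : 'C(t, 2) <= codegree B (x i) (x j) by apply: heavy; rewrite ?inj_eq.
  apply: leq_trans hv _.
  apply/subset_leq_card/subsetP => w; rewrite !inE => /and3P[-> iw jw] /=.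
  apply/forallP => k; apply/implyP; rewrite eij => /set2P[]-> //.
have [e0 _] : exists e : pair_of t, true.
  have /card_gt0P[e _] : 0 < #|{: pair_of t}|.
    by rewrite card_pairs_ord bin_gt0.
  by exists e.
have /card_gt0P[w0 _] : 0 < #|S e0|.
  by apply: leq_trans (cS e0); rewrite card_pairs_ord bin_gt0.
have [y yinj yS] := distinct_representatives w0 cS.
exists x, y; split=> // i e ie.
by have := yS e; rewrite inE => /andP[_ /forallP/(_ i)]; rewrite ie.
Qed.

(** Inside the neighbourhood of each [w] in [B] heavy pairs span no [K_t], so by Turán's theorem a
    fixed proportion of the pairs there is light or diagonal. After summation over [B] and
    Cauchy-Schwarz, the lower bound on the edge count absorbs the diagonal. Each light pair is
    counted fewer than ['C(t, 2)] times, and a vertex with most light neighbours is at least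
    average. *)
Lemma light_neighbours (A : {set U}) (B : {set W}) :
  1 < t -> ~ has_subdivision ->
  A != set0 -> 2 * t.-1 * #|B| <= edge_count A B ->
  exists2 u, u \in A &
    (edge_count A B) ^ 2
      <= 2 * t.-1 * 'C(t, 2) * #|B| * #|A| * #|[set v in A | light B u v]|.
Proof.
move=> t1 noK A0 large.
pose H u v := (u != v) && ('C(t, 2) <= codegree B u v).
have Hs : symmetric H by move=> u v; rewrite /H eq_sym codegreeC.
have Hi : irreflexive H by move=> u; rewrite /H eqxx.
pose N w := [set u in A | adj u w].
pose L w := \sum_(u in N w) #|[set v in N w | light B u v]|.
have locL w : w \in B -> #|N w| ^ 2 <= t.-1 * (L w + #|N w|).
  move=> wB; have := @card_nonadjacent_clique_free _ H t.-1 (N w) Hs Hi.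
  rewrite prednK ?(ltnW t1) // => /(_ _)/leq_trans; apply.
    move=> K KN Kt Kcl; apply: noK.
    apply: (@heavy_clique_subdivision B K) => // u v uK vK uv.
    by case/andP: (Kcl u v uK vK uv).
  rewrite leq_mul2l -[#|N w|]muln1 -sum_nat_const -big_split /=.
  apply/orP; right; apply: leq_sum => u uN.
  rewrite -(cards1 u); apply: leq_trans (leq_card_setU _ _).1.
  apply/subset_leq_card/subsetP => v; rewrite !inE /H negb_and negbK -ltnNge.
  rewrite [v == u]eq_sym /light; case: eqVneq => [->|uv]; first by rewrite !orbT.
  case/andP=> vN /= ->; rewrite vN /= andbT orbF /codegree.
  apply/card_gt0P; exists w; rewrite inE wB /=; case/andP: vN => _ ->.
  by move: uN; rewrite inE => /andP[_ ->].
have sumL : \sum_(w in B) L w <= 'C(t, 2) * \sum_(u in A) #|[set v in A | light B u v]|.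
  have -> : \sum_(w in B) L w =
      \sum_(u in A) \sum_(v in [set v in A | light B u v]) codegree B u v.
    transitivity (\sum_(w in B) \sum_(u in A) \sum_(v in [set v in A | light B u v])
                    (adj u w && adj v w : nat)).
      apply: eq_bigr => w _; rewrite /L big_mkcond [RHS]big_mkcond /=.
      apply: eq_bigr => u _; rewrite inE; case: (u \in A) => //=.
      case: (adj u w) => /=; last by rewrite big1.
      by rewrite -card_setId_sum; apply: eq_card => v; rewrite !inE andbAC.
    rewrite exchange_big /=; apply: eq_bigr => u _.
    by rewrite exchange_big /=; apply: eq_bigr => v _; rewrite /codegree card_setId_sum.
  rewrite big_distrr /=; apply: leq_sum => u _.
  rewrite mulnC -sum_nat_const; apply: leq_sum => v.
  by rewrite inE => /and4P[_ _ _ /ltnW].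
have [u uA umax] := exists_max_sum (fun u => #|[set v in A | light B u v]|) A0.
exists u => //; rewrite /= in umax; move: large; rewrite edge_countC -/(N _) => large.
have cs := sum_sqr_set B (fun w => #|N w|).
have sq : \sum_(w in B) #|N w| ^ 2 <=
    t.-1 * (\sum_(w in B) L w + \sum_(w in B) #|N w|).
  by rewrite -big_split big_distrr /=; apply: leq_sum => w; apply: locL.
rewrite /= in cs sq.
set X := \sum_(w in B) L w in sq sumL.
set S := \sum_(w in B) #|N w| in large cs sq *.
set l := #|[set v in A | light B u v]| in umax *.
set Y := \sum_(u in A) _ in sumL umax.
have {}sumL : X <= 'C(t, 2) * (#|A| * l) by apply: leq_trans sumL _; rewrite leq_mul2l umax orbT.
have {}cs : S ^ 2 <= #|B| * (t.-1 * (X + S)) by apply: leq_trans cs _; rewrite leq_mul2l sq orbT.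
have h1 : 2 * t.-1 * #|B| * S <= S ^ 2 by rewrite expnS expn1 leq_mul2r large orbT.
have h2 : #|B| * t.-1 * X <= #|B| * t.-1 * ('C(t, 2) * (#|A| * l)).
  by rewrite leq_mul2l sumL orbT.
move: cs h1 h2; rewrite mulnA mulnDr.
rewrite (_ : 2 * t.-1 * #|B| * S = 2 * (#|B| * t.-1 * S)); last by lia.
rewrite (_ : 2 * t.-1 * 'C(t, 2) * #|B| * #|A| * l =
             2 * (#|B| * t.-1 * ('C(t, 2) * (#|A| * l)))); last by ring.
by lia.
Qed.

(* The invariant of the greedy choice: [us] are the branch vertices chosen so far and
   [V] the vertices that may still be chosen.  Once no vertex of [B] sees three branch
   vertices, common neighbours of different pairs are automatically distinct. *)
Definition partial_clique (B : {set W}) (us : seq U) (V : {set U}) : Prop :=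
  [/\ uniq us, {in us &, forall u v, u != v -> 0 < codegree B u v},
      {in V & us, forall v u, light B u v},
      {in B, forall w, count (adj^~ w) us <= 2} &
      {in V & B, forall v w, adj v w -> count (adj^~ w) us <= 1}].

Lemma partial_clique_cons B us (V : {set U}) u (V' : {set U}) :
  partial_clique B us V -> u \in V -> V' \subset V ->
  {in V', forall v, light B u v} ->
  {in V' & B, forall v w, adj u w -> adj v w -> ~~ has (adj^~ w) us} ->
  partial_clique B (u :: us) V'.
Proof.
move=> [uus cus lus c2 c1] uV V'V lV' nV'; split.
- rewrite /= uus andbT; apply/negP => /(lus _ _ uV).
  by rewrite /light eqxx.
- move=> x y; rewrite !inE => /predU1P[->|xs] /predU1P[->|ys] xy.
  + by rewrite eqxx in xy.
  + by rewrite codegreeC; case/and3P: (lus _ _ uV ys).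
  + by case/and3P: (lus _ _ uV xs).
  + exact: cus.
- move=> v x vV'; rewrite inE => /predU1P[->|xs]; first exact: lV'.
  by apply: lus => //; apply: (subsetP V'V).
- move=> w wB /=; case: (boolP (adj u w)) => [uw|_] /=; last exact: c2.
  by rewrite add1n ltnS; apply: (c1 u).
- move=> v w vV' wB vw /=; case: (boolP (adj u w)) => [uw|_] /=.
    by have := nV' v w vV' wB uw vw; rewrite has_count -leqNgt; case: count.
  by apply: (c1 v) => //; apply: (subsetP V'V).
Qed.

(** Common neighbours may be picked arbitrarily: a vertex of [B] sees at most two branch vertices,
    so it determines the pair that it subdivides. *)
Lemma partial_clique_subdivision B us V :
  partial_clique B us V -> size us = t -> 1 < t -> has_subdivision.
Proof.
move=> [uus cus _ c2 _] st t1.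
have u0 : U by case: us st t1 {uus cus c2} => [<-|u us].
pose x (i : 'I_t) := nth u0 us i.
have xus i : x i \in us by rewrite mem_nth ?st.
have xinj : injective x.
  by move=> i j /eqP; rewrite nth_uniq ?st // => /eqP/val_inj.
have wex (e : pair_of t) :
    exists w, (w \in B) && [forall i in val e, adj (x i) w].
  have /cards2P[i [j [ij eij]]] : #|val e| == 2 := valP e.
  have : 0 < codegree B (x i) (x j) by apply: cus; rewrite ?inj_eq.
  case/card_gt0P => w; rewrite inE => /and3P[wB iw jw]; exists w; rewrite wB /=.
  by apply/forallP => k; apply/implyP; rewrite eij => /set2P[]->.
pose y e := xchoose (wex e).
have yB e : y e \in B by case/andP: (xchooseP (wex e)).
have yadj (e : pair_of t) i : i \in val e -> adj (x i) (y e).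
  by move=> ie; case/andP: (xchooseP (wex e)) => _ /forallP/(_ i); rewrite ie.
exists x, y; split=> [//||i e]; last exact: yadj.
move=> e e' ye; apply: val_inj; pose X := [set i | adj (x i) (y e)].
have X2 : #|X| <= 2.
  apply: leq_trans (c2 _ (yB e)); rewrite -size_filter.
  have inX : {subset [seq x i | i in X] <= [seq u <- us | adj u (y e)]}.
    move=> u /mapP[i]; rewrite mem_enum inE => iX ->.
    by rewrite mem_filter iX xus.
  rewrite -(size_image x X); apply: uniq_leq_size inX.
  by rewrite map_inj_uniq ?enum_uniq.
have eX (f : pair_of t) : y f = y e -> val f = X.
  move=> yf; apply/eqP; rewrite eqEcard (eqP (valP f)) X2 andbT.
  by apply/subsetP => i; rewrite inE -yf; apply: yadj.
by rewrite (eX e) // (eX e').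
Qed.

(** [bad] collects the vertices of [A] that see a common neighbour of [u] and an earlier branch
    vertex. By lightness each earlier vertex has fewer than ['C(t, 2)] such common neighbours, each
    with at most [D] neighbours in [A]. *)
Lemma partial_clique_extend (A : {set U}) (B : {set W}) us (V : {set U}) u D :
  {in B, forall w, #|[set v in A | adj v w]| <= D} ->
  partial_clique B us V -> u \in V -> V \subset A ->
  exists V' : {set U}, [/\ V' \subset V, partial_clique B (u :: us) V' &
    #|[set v in V | light B u v]| <= #|V'| + size us * ('C(t, 2) * D)].
Proof.
move=> degB pc uV VA.
pose bad := \bigcup_(w in [set w in B | adj u w && has (adj^~ w) us])
              [set v in A | adj v w].
have badP v : v \in bad -> exists w, [&& w \in B, adj u w, adj v w & has (adj^~ w) us].
  case/bigcupP => w; rewrite !inE => /and3P[wB uw wus] /andP[_ vw].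
  by exists w; rewrite wB uw vw.
have cbad : #|bad| <= size us * ('C(t, 2) * D).
  apply: (@leq_trans (\sum_(w in [set w in B | adj u w && has (adj^~ w) us]) D)).
    apply: (@leq_trans (\sum_(w in [set w in B | adj u w && has (adj^~ w) us])
                         #|[set v in A | adj v w]|)).
      apply: (big_ind2 (fun (X : {set U}) n => #|X| <= n)) => //.
        by rewrite cards0.
      move=> X m Y n Xm Yn; apply: leq_trans (leq_card_setU _ _).1 _.
      exact: leq_add.
    by apply: leq_sum => w; rewrite inE => /andP[/degB].
  rewrite sum_nat_const mulnA leq_mul2r; apply/orP; right.
  have {}pc : {in us, forall v, codegree B v u <= 'C(t, 2)}.
    by case: pc => _ _ lus _ _ v vus; case/and3P: (lus _ _ uV vus) => _ _ /ltnW.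
  elim: us pc {bad badP} => [|x us IH] pc.
    rewrite (_ : [set _ in _ | _] = set0) ?cards0 //; apply/setP => w.
    by rewrite !inE !andbF.
  rewrite /= mulSn; apply: leq_trans (leq_add (pc x (mem_head _ _)) (IH _)); last first.
    by move=> v vus; apply: pc; rewrite inE vus orbT.
  apply: leq_trans (leq_card_setU _ _).1; apply/subset_leq_card/subsetP => w.
  by rewrite !inE => /and3P[-> -> /orP[->|->]]; rewrite ?orbT.
exists ([set v in V | light B u v] :\: bad); split.
- by apply/subsetP => v; rewrite !inE => /and3P[].
- apply: (partial_clique_cons pc) => //.
  + by apply/subsetP => v; rewrite !inE => /and3P[].
  + by move=> v; rewrite !inE => /and3P[].
  + move=> v w; rewrite !inE => /andP[vbad /andP[vV _]] wB uw vw.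
    apply: contra vbad => wus; apply/bigcupP; exists w; rewrite !inE ?wB ?uw //.
    by rewrite vw (subsetP VA).
- rewrite addnC -leq_subLR cardsD leq_sub2l //.
  by apply: leq_trans cbad; apply/subset_leq_card/subsetIr.
Qed.

End Bipartite.

(** * Iterating the greedy choice *)

Section Greedy.
Variables (R : realFieldType) (U W : finType) (adj : U -> W -> bool) (t : nat).
Variables (A : {set U}) (B : {set W}) (b D : nat) (d : R).
Hypothesis t1 : 1 < t.
Hypothesis free : ~ has_subdivision adj t.
Hypothesis b0 : 0 < b.
Hypothesis Bb : #|B| <= b.
Hypothesis d0 : (0 < d)%R.
Hypothesis degA : {in A, forall u, (d <= #|[set w in B | adj u w]|%:R)%R}.
Hypothesis degB : {in B, forall w, #|[set v in A | adj v w]| <= D}.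

(** [light_neighbours] keeps a proportion [2 * rho] of the candidates; one half of it pays for the
    bad vertices, so the candidates shrink by a factor [rho] per step. *)
Let rho : R := (d ^+ 2 / (4 * t * 'C(t, 2) * b)%:R)%R.

Lemma light_neighbours_ratio (V : {set U}) :
  V \subset A -> V != set0 -> ((2 * t * b)%:R <= d * #|V|%:R)%R ->
  exists2 u, u \in V & (2 * rho * #|V|%:R <= #|[set v in V | light adj t B u v]|%:R)%R.
Proof.
move=> VA V0 large.
have c0 : 0 < 'C(t, 2) by rewrite bin_gt0.
have cV : 0 < #|V| by rewrite card_gt0.
have ec : (d * #|V|%:R <= (edge_count adj V B)%:R)%R.
  rewrite /edge_count natr_sum mulr_natr -sumr_const.
  by apply: ler_sum => u uV; apply/degA/(subsetP VA).
have [|u uV le] := light_neighbours t1 free V0 (B := B).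
  rewrite -(ler_nat R); apply: le_trans (le_trans large ec); rewrite ler_nat.
  by apply: leq_mul Bb; lia.
exists u => //; move: le; set l := #|[set v in V | _]|; set ecV := edge_count _ _ _ in ec *.
move=> le.
have {}le : ecV ^ 2 <= 2 * t * 'C(t, 2) * b * #|V| * l.
  apply: leq_trans le _; rewrite !leq_mul //; lia.
have le2 : ((d * #|V|%:R) ^+ 2 <= (2 * t * 'C(t, 2) * b * #|V| * l)%:R :> R)%R.
  apply: (@le_trans _ _ ((ecV ^ 2)%:R : R)%R); last by rewrite ler_nat.
  by rewrite natrX lerXn2r // nnegrE ?mulr_ge0 // ltW.
have V0R : (0 < #|V|%:R :> R)%R by rewrite ltr0n.
rewrite /rho; have K0 : (0 < (4 * t * 'C(t, 2) * b)%:R :> R)%R.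
  by rewrite ltr0n !muln_gt0 (ltnW t1) c0 b0.
rewrite (_ : _ * _ = 2 * d ^+ 2 * #|V|%:R / (4 * t * 'C(t, 2) * b)%:R)%R; last by ring.
rewrite ler_pdivrMr // -(ler_pM2r V0R).
apply: (@le_trans _ _ (2 * (d * #|V|%:R) ^+ 2)%R).
  by rewrite le_eqVlt; apply/orP; left; apply/eqP; ring.
apply: (@le_trans _ _ (2 * (2 * t * 'C(t, 2) * b * #|V| * l)%:R)%R).
  by rewrite ler_pM2l.
by rewrite le_eqVlt; apply/orP; left; apply/eqP; rewrite !natrM; ring.
Qed.

(** The first bound yields [rho <= 1], the second keeps [light_neighbours_ratio] applicable while
    the candidate set shrinks, and the third controls the bad vertices at every step. *)
Lemma greedy_contradiction :
  ((2 * t * b)%:R <= d * #|A|%:R)%R ->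
  ((2 * t * b)%:R <= d * (rho ^+ (t - 2) * #|A|%:R))%R ->
  ((t * ('C(t, 2) * D))%:R <= rho ^+ (t - 1) * #|A|%:R)%R -> False.
Proof.
move=> large0 large1 large2.
have b2 : (0 < (2 * t * b)%:R :> R)%R by rewrite ltr0n; nia.
have c0 : 0 < 'C(t, 2) by rewrite bin_gt0.
have A0R : (0 < #|A|%:R :> R)%R by have := lt_le_trans b2 large0; rewrite pmulr_rgt0.
have A0 : A != set0 by rewrite -card_gt0 -(ltr0n R).
have r0 : (0 < rho)%R by rewrite /rho divr_gt0 ?exprn_gt0 // ltr0n; nia.
have r1 : (rho <= 1)%R.
  have [u uA le] := light_neighbours_ratio (subxx A) A0 large0.
  have : (2 * rho * #|A|%:R <= #|A|%:R)%R.
    apply: le_trans le _; rewrite ler_nat.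
    by apply/subset_leq_card/subsetP => v; rewrite inE => /andP[].
  by rewrite ger_pMl // => ?; lra.
have mono i j : i <= j -> (rho ^+ j * #|A|%:R <= rho ^+ i * #|A|%:R)%R.
  by move=> ij; rewrite ler_pM2r //; apply: ler_wiXn2l => //; apply: ltW.
have step (V : {set U}) : (rho ^+ (t - 2) * #|A|%:R <= #|V|%:R :> R)%R ->
    V \subset A -> exists2 u, u \in V &
    (2 * rho * #|V|%:R <= #|[set v in V | light adj t B u v]|%:R)%R.
  move=> cV VA; apply: light_neighbours_ratio => //.
    rewrite -card_gt0 -(ltr0n R); apply: lt_le_trans cV.
    by rewrite mulr_gt0 // exprn_gt0.
  by apply: le_trans large1 _; rewrite ler_pM2l.
have iter j : j <= t - 1 -> exists us (V : {set U}),
    [/\ size us = j, V \subset A, partial_clique adj t B us V &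
        (rho ^+ j * #|A|%:R <= #|V|%:R)%R].
  elim: j => [_|j IH jt].
    by exists [::], A; split; rewrite ?expr0 ?mul1r.
  have [us [V [sus VA pc cV]]] := IH (ltnW jt).
  have [|u uV lu] := step V _ VA.
    by apply: le_trans cV; apply: mono; lia.
  have [V' [V'V pc' cV']] := partial_clique_extend degB pc uV VA.
  exists (u :: us), V'; split=> //=; first by rewrite sus.
    exact: subset_trans VA.
  have h1 : (2 * rho * #|V|%:R <= #|V'|%:R + (t * ('C(t, 2) * D))%:R)%R.
    apply: le_trans lu _; rewrite -natrD ler_nat; apply: leq_trans cV' _.
    by rewrite leq_add2l sus leq_mul2r; apply/orP; right; lia.
  have h2 : (rho ^+ j.+1 * #|A|%:R <= rho * #|V|%:R)%R.
    by rewrite exprS -mulrA ler_pM2l.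
  have h3 := le_trans large2 (mono _ _ jt).
  lra.
(* The last branch vertex may be any remaining candidate, so [t - 1] rounds of shrinking suffice. *)
have [us [V [sus VA pc cV]]] := iter _ (leqnn _).
have : 0 < #|V|.
  by rewrite -(ltr0n R); apply: lt_le_trans cV; rewrite mulr_gt0 // exprn_gt0.
case/card_gt0P => u uV.
have [V' [_ pc' _]] := partial_clique_extend degB pc uV VA.
apply: free; apply: (partial_clique_subdivision pc') => //=; rewrite sus; lia.
Qed.

End Greedy.

(** * Extremal pairs and the bound on K_t^+-free graphs *)

Section Extremal.
Variables (U W : finType) (adj : U -> W -> bool) (k : nat).

(* Shrinking the larger side to the size of the smaller one by sampling preserves
   [edge_count ^ (2k+1) / pair_weight], so the normalisation by the maximum only
   penalises unbalanced pairs such as stars. *)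
Definition pair_weight (A : {set U}) (B : {set W}) : nat :=
  minn #|A| #|B| ^ k * maxn #|A| #|B| ^ k.*2.+1.

(** Maximality of [edge_count ^ (2k+1) / pair_weight], cross-multiplied. It is used with
    [k = t - 2], so that [2k + 1 = 2t - 3]. *)
Definition extremal_pair (A : {set U}) (B : {set W}) : Prop :=
  forall (A' : {set U}) (B' : {set W}), A' != set0 -> B' != set0 ->
    edge_count adj A' B' ^ k.*2.+1 * pair_weight A B <=
    edge_count adj A B ^ k.*2.+1 * pair_weight A' B'.

Lemma pair_weight_gt0 (A : {set U}) (B : {set W}) : A != set0 -> B != set0 -> 0 < pair_weight A B.
Proof.
rewrite -!card_gt0 => A0 B0.
by rewrite /pair_weight muln_gt0 !expn_gt0 leq_min leq_max A0 B0.
Qed.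

Lemma extremal_pair_exists (A0 : {set U}) (B0 : {set W}) : A0 != set0 -> B0 != set0 ->
  exists A B, [/\ A != set0, B != set0 & extremal_pair A B].
Proof.
move=> nA0 nB0.
pose phi (AB : {set U} * {set W}) : rat :=
  ((edge_count adj AB.1 AB.2 ^ k.*2.+1)%:R / (pair_weight AB.1 AB.2)%:R)%R.
pose P (AB : {set U} * {set W}) := (AB.1 != set0) && (AB.2 != set0).
have P0 : P (A0, B0) by apply/andP.
case: (@Order.TotalTheory.arg_maxP _ _ _ (A0, B0) P phi P0) => -[A B] /andP[/= nA nB] AB.
exists A, B; split=> // A' B' nA' nB'.
have := AB (A', B'); rewrite /P /= nA' nB' => /(_ isT); rewrite /phi /=.
rewrite ler_pdivrMr ?ltr0n ?pair_weight_gt0 // mulrAC.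
by rewrite ler_pdivlMr ?ltr0n ?pair_weight_gt0 // -!natrM ler_nat.
Qed.

End Extremal.

Lemma edge_countS (U W : finType) (adj : U -> W -> bool) (A A' : {set U}) (B B' : {set W}) :
  A \subset A' -> B \subset B' -> edge_count adj A B <= edge_count adj A' B'.
Proof.
move=> AA' BB'; rewrite /edge_count [X in _ <= X](big_setID A) /= (setIidPr AA').
apply: leq_trans (leq_addr _ _); apply: leq_sum => u _.
by apply/subset_leq_card/subsetP => w; rewrite !inE => /andP[/(subsetP BB')-> ->].
Qed.

(** * Almost regularity of extremal pairs *)

Section Regular.
Variables (U W : finType) (adj : U -> W -> bool) (k : nat).
Variables (A : {set U}) (B : {set W}).
Hypothesis k0 : 0 < k.
Hypothesis extAB : extremal_pair adj k A B.
Hypothesis A0 : A != set0.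
Hypothesis AB : #|A| <= #|B|.
Let e := edge_count adj A B.
Hypothesis e0 : 0 < e.

Let a0 : 0 < #|A|. Proof. by rewrite card_gt0. Qed.
Let b0 : 0 < #|B|. Proof. exact: leq_trans AB. Qed.
Let B0 : B != set0. Proof. by rewrite -card_gt0. Qed.

(** Maximality is applied to [(A, B')]. If [#|A| <= #|B'|], the average degree in [B'] cannot exceed
    that in [B], a contradiction. Otherwise, with [X = #|B| * e'], it combines with
    [16 * e * #|B'| <= X] into [16^k X^(k+1) <= (e #|A|)^(k+1)], and [4^(k+1) <= 16^k] as [k] is
    positive. *)
Lemma extremal_high_degree (B' : {set W}) : B' \subset B ->
  {in B', forall w, 16 * e <= #|B| * #|[set u in A | adj u w]|} ->
  4 * edge_count adj A B' <= e.
Proof.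
move=> B'B high.
have [->|nB'] := eqVneq B' set0.
  by rewrite edge_countC big_set0 muln0.
have b'0 : 0 < #|B'| by rewrite card_gt0.
have := extAB A0 nB'; rewrite -/e; set e' := edge_count adj A B'.
have sumhigh : 16 * e * #|B'| <= #|B| * e'.
  rewrite /e' edge_countC [X in _ <= X]big_distrr /= mulnC -sum_nat_const.
  by apply: leq_sum => w; apply: high.
rewrite /pair_weight (minn_idPl AB) (maxn_idPr AB).
case: (leqP #|A| #|B'|) => ab'.
  rewrite (mulnCA _ (_ ^ k)) [X in _ <= X](mulnCA _ (_ ^ k)) leq_pmul2l ?expn_gt0 ?a0 //.
  rewrite -!expnMn leq_exp2r // => le.
  have : 16 * e * #|B'| <= 1 * e * #|B'| by rewrite mul1n (leq_trans sumhigh) // mulnC.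
  by rewrite leq_pmul2r // leq_pmul2r.
set X := #|B| * e' in sumhigh *.
have X0 : 0 < X by apply: leq_trans sumhigh; rewrite !muln_gt0 e0.
have -> : e' ^ k.*2.+1 * (#|A| ^ k * #|B| ^ k.*2.+1) = #|A| ^ k * X ^ k.*2.+1.
  by rewrite /X expnMn; ring.
have -> : e ^ k.*2.+1 * (#|B'| ^ k * #|A| ^ k.*2.+1) =
          #|A| ^ k * ((e * #|A|) ^ k.+1 * (e * #|B'|) ^ k).
  by rewrite !expnMn -addnn -addnS !expnD; ring.
rewrite leq_pmul2l ?expn_gt0 ?a0 // => le.
have le2 : X ^ k * (X ^ k.+1 * 16 ^ k) <= X ^ k * (e * #|A|) ^ k.+1.
  rewrite mulnA -expnD addnS addnn.
  apply: leq_trans (leq_mul le (leqnn (16 ^ k))) _.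
  rewrite -mulnA mulnC leq_mul2r; apply/orP; right.
  by rewrite -expnMn leq_exp2r // mulnC mulnA.
rewrite leq_pmul2l ?expn_gt0 ?X0 // in le2.
have {}le2 : (4 * X) ^ k.+1 <= (e * #|A|) ^ k.+1.
  apply: leq_trans le2; rewrite expnMn mulnC leq_mul2l; apply/orP; right.
  by rewrite (_ : 16 = 4 ^ 2) // -expnM leq_exp2l //; lia.
rewrite leq_exp2r // in le2.
have : #|B| * (4 * e') <= #|B| * e.
  rewrite mulnCA (leq_trans le2) // mulnC leq_mul2r AB orbT //.
by rewrite leq_pmul2l.
Qed.

(** Maximality bounds [(#|A| / #|A'|)^k] by [2^(2k+1)], which is at most [8^k] because [k] is
    positive. *)
Lemma extremal_dense_subset (A' : {set U}) : A' \subset A ->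
  e <= 2 * edge_count adj A' B -> #|A| <= 8 * #|A'|.
Proof.
move=> A'A dense; set e' := edge_count adj A' B in dense.
have e'0 : 0 < e' by lia.
have nA' : A' != set0.
  by apply: contraTneq e'0 => A'0; rewrite /e' A'0 /edge_count big_set0.
have := extAB nA' B0; rewrite -/e -/e' /pair_weight.
have a'a := subset_leq_card A'A; have a'b := leq_trans a'a AB.
rewrite (minn_idPl AB) (maxn_idPr AB) (minn_idPl a'b) (maxn_idPr a'b).
rewrite !mulnA leq_pmul2r ?expn_gt0 ?b0 // => le.
rewrite -(leq_exp2r _ _ k0) -(@leq_pmul2l (e' ^ k.*2.+1)) ?expn_gt0 ?e'0 //.
apply: leq_trans le _.
rewrite expnMn mulnA leq_mul2r; apply/orP; right.
apply: leq_trans (_ : (2 * e') ^ k.*2.+1 <= _); first by rewrite leq_exp2r.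
rewrite expnMn mulnC leq_mul2l; apply/orP; right.
by rewrite (_ : 8 = 2 ^ 3) // -expnM leq_exp2l //; lia.
Qed.

Lemma extremal_regular_core : exists (A1 : {set U}) (B1 : {set W}),
  [/\ #|A| <= 8 * #|A1|, #|B1| <= #|B|,
      {in A1, forall u, e <= 4 * #|A| * #|[set w in B1 | adj u w]|} &
      {in B1, forall w, #|B| * #|[set u in A1 | adj u w]| <= 16 * e}].
Proof.
(* High degrees are cut in [B] first, so that the lower bounds in [A1] refer to [B1]; shrinking [A]
   afterwards keeps the upper bounds. Each cut loses at most a quarter of the edges. *)
pose B1 := [set w in B | #|B| * #|[set u in A | adj u w]| <= 16 * e].
pose A1 := [set u in A | e <= 4 * #|A| * #|[set w in B1 | adj u w]|].
have B1B : B1 \subset B by apply/subsetP => w; rewrite inE => /andP[].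
have A1A : A1 \subset A by apply/subsetP => w; rewrite inE => /andP[].
exists A1, B1; split.
- apply: extremal_dense_subset => //.
  have h1 : 4 * edge_count adj A (B :\: B1) <= e.
    apply: extremal_high_degree => [|w]; first exact: subsetDl.
    rewrite inE => /andP[w1 wB]; move: w1; rewrite inE wB /= -ltnNge.
    exact: ltnW.
  have h2 : e = edge_count adj A B1 + edge_count adj A (B :\: B1).
    by rewrite /e !edge_countC (big_setID B1) /= (setIidPr B1B).
  have h3 : edge_count adj A B1 = edge_count adj A1 B1 + edge_count adj (A :\: A1) B1.
    by rewrite /edge_count (big_setID A1) /= (setIidPr A1A).
  have h4 : 4 * edge_count adj (A :\: A1) B1 <= e.
    rewrite -(leq_pmul2l a0); apply: (@leq_trans (#|A :\: A1| * e)); last first.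
      by rewrite leq_mul2r subset_leq_card ?orbT // subsetDl.
    rewrite mulnA [X in X <= _]big_distrr /= -[#|A :\: A1| * e]sum_nat_const; apply: leq_sum => u.
    rewrite inE => /andP[u1 uA]; move: u1; rewrite inE uA /= -ltnNge => /ltnW.
    by rewrite (mulnC #|A|).
  have := edge_countS adj (subxx A1) B1B.
  lia.
- exact: subset_leq_card.
- by move=> u; rewrite inE => /andP[].
- move=> w; rewrite inE => /andP[_]; apply: leq_trans.
  rewrite leq_mul2l; apply/orP; right; apply/subset_leq_card/subsetP => u.
  by rewrite !inE => /andP[/andP[-> _] ->].
Qed.

(** The regular core enters the greedy argument with [d = e / (4 #|A|)] and [D] the integer part of
    [16 e / #|B|]. Then [rho = e^2 / (G #|A|^2 #|B|)], which dictates [G]; its exponent in the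
    density hypothesis is generous. *)
Lemma extremal_has_subdivision :
  let G := 64 * k.+2 * 'C(k.+2, 2) in
  G ^ k.+3.*2 * (#|A| ^ k * #|B| ^ k.*2.+1) <= e ^ k.*2.+1 ->
  ~ has_subdivision adj k.+2 -> False.
Proof.
move=> G dense free.
have [A1 [B1 [A1A B1B degA degB]]] := extremal_regular_core.
have c0 : 0 < 'C(k.+2, 2) by rewrite bin_gt0.
have G1 : 1 < G by rewrite /G; nia.
have G0 := ltnW G1.
have GX i j : i <= j -> G ^ i <= G ^ j by move=> ij; rewrite leq_exp2l.
have e64 : 64 * k.+2 * #|B| <= e.
  rewrite -(leq_exp2r _ _ (ltn0Sn k.*2)); apply: leq_trans dense; rewrite expnMn mulnA.
  rewrite leq_mul2r; apply/orP; right.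
  apply: (@leq_trans (G ^ k.*2.+1)); first by rewrite leq_exp2r // /G leq_pmulr.
  apply: leq_trans (GX _ (k.+3.*2) _) _; first by lia.
  by rewrite leq_pmulr // expn_gt0 a0.
(* Since [#|A| <= #|B|], moving exponents from [#|A|] to [#|B|] at total degree [3k + 1] only
   increases a monomial. *)
have balance i : k <= i <= k.*2.+1 ->
    #|A| ^ i * #|B| ^ (k.*2.+1 + k - i) <= #|A| ^ k * #|B| ^ k.*2.+1.
  case/andP=> ki ik; rewrite -{1}(subnK ki) expnD -mulnA mulnCA leq_mul2l.
  apply/orP; right; rewrite [X in _ <= _ ^ X](_ : _ = (i - k) + (k.*2.+1 + k - i)); last by lia.
  rewrite expnD leq_mul2r; apply/orP; right.
  by case: (i - k) => // m; rewrite leq_exp2r.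
have GABX i : (G * #|A| ^ 2 * #|B|) ^ i = G ^ i * #|A| ^ i.*2 * #|B| ^ i.
  by rewrite (expnMn (G * _)) (expnMn G) -expnM mul2n.
(* With [#|A| / 8] in place of [#|A1|] and denominators cleared, [e64], [pow1] and [pow2] are the
   three numerical hypotheses of [greedy_contradiction]. *)
have pow1 : 64 * k.+2 * #|B| * (G * #|A| ^ 2 * #|B|) ^ k <= e ^ k.*2.+1.
  apply: leq_trans dense.
  apply: (@leq_trans (G ^ k.+1 * (#|A| ^ k.*2 * #|B| ^ k.+1))).
    rewrite GABX (expnS G) (expnS #|B|).
    rewrite (_ : _ * _ = 64 * k.+2 * (G ^ k * #|A| ^ k.*2 * #|B| ^ k * #|B|)); last by ring.
    rewrite [X in _ <= X](_ : _ = G * (G ^ k * #|A| ^ k.*2 * #|B| ^ k * #|B|)); last by ring.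
    by rewrite leq_mul2r; apply/orP; right; rewrite /G leq_pmulr.
  apply: leq_mul; first by apply: GX; lia.
  have := balance k.*2; rewrite (_ : k.*2.+1 + k - k.*2 = k.+1); last by lia.
  by apply; lia.
have pow2 : 128 * k.+2 * 'C(k.+2, 2) * e * (G * #|A| ^ 2 * #|B|) ^ k.+1 <=
            e ^ k.*2.+2 * #|A| * #|B|.
  have -> : 128 * k.+2 * 'C(k.+2, 2) * e * (G * #|A| ^ 2 * #|B|) ^ k.+1 =
            e * #|A| * #|B| * (2 * G ^ k.+2 * (#|A| ^ k.*2.+1 * #|B| ^ k)).
    by rewrite GABX doubleS !expnS /G; ring.
  have -> : e ^ k.*2.+2 * #|A| * #|B| = e * #|A| * #|B| * e ^ k.*2.+1.
    by rewrite expnS; ring.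
  rewrite leq_mul2l; apply/orP; right; apply: leq_trans dense; apply: leq_mul.
    apply: leq_trans (GX k.+3 _ _); last by lia.
    by rewrite (expnS G k.+2) leq_mul2r G1 orbT.
  have := balance k.*2.+1; rewrite addKn; apply; lia.
have aR : (0 < #|A|%:R :> rat)%R by rewrite ltr0n.
have bR : (0 < #|B|%:R :> rat)%R by rewrite ltr0n.
have eR : (0 < e%:R :> rat)%R by rewrite ltr0n.
pose d : rat := (e%:R / (4 * #|A|)%:R)%R.
have a4 : (0 < (4 * #|A|)%:R :> rat)%R by rewrite ltr0n muln_gt0.
have d0 : (0 < d)%R by rewrite divr_gt0.
have A1R : (#|A|%:R / 8 <= #|A1|%:R :> rat)%R.
  by rewrite ler_pdivrMr // -natrM ler_nat mulnC.
pose Q : rat := (G * #|A| ^ 2 * #|B|)%:R.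
have Q0 : (0 < Q)%R by rewrite ltr0n (muln_gt0 (G * _)) (muln_gt0 G) expn_gt0 G0 a0 b0.
have rhoE : (d ^+ 2 / (4 * k.+2 * 'C(k.+2, 2) * #|B|)%:R = e%:R ^+ 2 / Q)%R.
  rewrite /d /Q /G !natrM; field.
  by rewrite -natrD !pnatr_eq0 -!lt0n c0 a0 b0.
have dA i : (d * (#|A|%:R / 8) * i = e%:R * i / 32)%R.
  by rewrite /d natrM; field; rewrite pnatr_eq0 -lt0n a0.
apply: (@greedy_contradiction rat _ _ adj k.+2 A1 B1 #|B| ((16 * e) %/ #|B|) d) => //.
- move=> u /degA le; rewrite /d ler_pdivrMr // -natrM ler_nat mulnC //.
- by move=> w /degB le; rewrite leq_divRL // mulnC.
- apply: (@le_trans _ _ (d * (#|A|%:R / 8)))%R; last by rewrite ler_pM2l.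
  rewrite -[X in (_ <= X)%R]mulr1 dA mulr1 ler_pdivlMr // -natrM ler_nat.
  by apply: leq_trans e64; rewrite leq_eqVlt; apply/orP; left; apply/eqP; ring.
- rewrite rhoE subn2 /=.
  apply: (@le_trans _ _ (d * ((e%:R ^+ 2 / Q) ^+ k * (#|A|%:R / 8))))%R; last first.
    by rewrite ler_pM2l // ler_pM2l // exprn_gt0 // divr_gt0 // exprn_gt0.
  rewrite (mulrC (_ ^+ k)%R) mulrA dA ler_pdivlMr // expr_div_n mulrA.
  rewrite ler_pdivlMr ?exprn_gt0 // -exprM -exprS -natrM /Q -!natrX -natrM ler_nat.
  rewrite (mul2n k); apply: leq_trans pow1.
  by rewrite leq_eqVlt; apply/orP; left; apply/eqP; ring.
- rewrite rhoE subn1 /=.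
  apply: (@le_trans _ _ ((e%:R ^+ 2 / Q) ^+ k.+1 * (#|A|%:R / 8)))%R; last first.
    by rewrite ler_pM2l // exprn_gt0 // divr_gt0 // exprn_gt0.
  rewrite mulrA ler_pdivlMr // expr_div_n mulrAC ler_pdivlMr ?exprn_gt0 //.
  rewrite -(ler_pM2r bR) -exprM mul2n doubleS /Q -!natrX -!natrM ler_nat.
  apply: leq_trans pow2; have := leq_trunc_div (16 * e) #|B|.
  set q := _ %/ _; set Z := _ ^ k.+1 => le.
  rewrite (_ : _ * #|B| = q * #|B| * (8 * k.+2 * 'C(k.+2, 2) * Z)); last by ring.
  rewrite (_ : 128 * _ * _ * _ * _ = 16 * e * (8 * k.+2 * 'C(k.+2, 2) * Z)); last by ring.
  by rewrite leq_mul2r le orbT.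
Qed.
End Regular.

(** * Labelings, and the passage from bipartite to general graphs *)

Lemma card_labelings (V : finType) m (p : 'I_m -> V) : injective p ->
  m ^ #|V| <= m ^ m * #|[set f : {ffun V -> 'I_m} | [forall i, f (p i) == i]]|.
Proof.
move=> pinj.
(* [F] records the values of [f] at the points [p i] and overwrites them by the prescribed labels,
   so [f] can be recovered. *)
pose F (f : {ffun V -> 'I_m}) : {ffun 'I_m -> 'I_m} * {ffun V -> 'I_m} :=
  ([ffun i => f (p i)], [ffun v => if [pick i | p i == v] is Some i then i else f v]).
have Finj : injective F.
  move=> f g [/ffunP h1 /ffunP h2]; apply/ffunP => v.
  case: (pickP (fun i => p i == v)) => [i /eqP <-|nov].
    by have := h1 i; rewrite !ffunE.
  have := h2 v; rewrite !ffunE; case: pickP => [j jv|_ //].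
  by have := nov j; rewrite jv.
have -> : m ^ #|V| = #|F @: [set: {ffun V -> 'I_m}]|.
  by rewrite card_imset // cardsT card_ffun card_ord.
have -> : m ^ m = #|[set: {ffun 'I_m -> 'I_m}]|.
  by rewrite cardsT card_ffun card_ord.
rewrite -cardsX; apply/subset_leq_card/subsetP => _ /imsetP[f _ ->].
rewrite !inE /=; apply/forallP => i; rewrite ffunE.
by case: pickP => [j /eqP/pinj-> //|/(_ i)]; rewrite eqxx.
Qed.

(** Averaging: a random labeling puts the prescribed labels on the points of [p z] with probability
    at least [1 / m.+1 ^ m.+1]. Two labels serve to make a graph bipartite, four to separate the
    endpoints of two edges. *)
Lemma exists_good_labeling (V T : finType) m (p : T -> 'I_m.+1 -> V) (Q : {set T}) :
  {in Q, forall z, injective (p z)} ->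
  exists f : {ffun V -> 'I_m.+1},
    #|Q| <= m.+1 ^ m.+1 * #|[set z in Q | [forall i, f (p z i) == i]]|.
Proof.
move=> pinj.
have n0 : [set: {ffun V -> 'I_m.+1}] != set0.
  by apply/set0Pn; exists [ffun=> ord0].
have [f _ fmax] := exists_max_sum
  (fun f : {ffun V -> 'I_m.+1} => #|[set z in Q | [forall i, f (p z i) == i]]|) n0.
exists f; rewrite cardsT card_ffun card_ord /= in fmax.
have pos : 0 < m.+1 ^ #|V| by rewrite expn_gt0.
rewrite -(leq_pmul2l pos) mulnCA.
apply: (@leq_trans (m.+1 ^ m.+1 * \sum_(f in [set: {ffun V -> 'I_m.+1}])
   #|[set z in Q | [forall i, f (p z i) == i]]|)); last by rewrite leq_mul2l fmax orbT.
under eq_bigr do rewrite card_setId_sum.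
rewrite exchange_big big_distrr /= mulnC -sum_nat_const; apply: leq_sum => z zQ.
apply: leq_trans (card_labelings (pinj z zQ)) _.
by rewrite leq_mul2l -card_setId_sum; apply/orP; right; apply/subset_leq_card/subsetP => g;
  rewrite !inE.
Qed.

Lemma contains_subdivided_clique (T : finType) (E : {set {set T}}) (L : {set T}) t
    (x : 'I_t -> T) (y : pair_of t -> T) :
  injective x -> injective y -> (forall i, x i \in L) -> (forall e, y e \notin L) ->
  (forall i (e : pair_of t), i \in val e -> [set x i; y e] \in E) ->
  contains_copy E (subdivided_clique t).
Proof.
move=> xinj yinj xL yL xyE.
apply/existsP; exists [ffun v : subdivided_clique t =>
  match v with inl i => x i | inr e => y e end]; apply/andP; split.
  apply/injectiveP => -[i|e] [j|e']; rewrite !ffunE.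
  - by move/xinj->.
  - by move=> xy; have := xL i; rewrite xy (negPf (yL _)).
  - by move=> xy; have := xL j; rewrite -xy (negPf (yL _)).
  - by move/yinj->.
apply/forallP => s; apply/implyP => /imsetP[[i e] /= ie ->].
by rewrite imsetU !imset_set1 !ffunE; apply: xyE; rewrite inE in ie.
Qed.

(** An extremal pair inherits the density of the whole graph, whose weight is [n ^ (3k+1)]. Either
    side of that pair may be the smaller one, so both orientations of [K_t^+] have to be
    excluded. *)
Lemma subdivision_free_bipartite (U W : finType) (adj : U -> W -> bool) k n :
  0 < k -> #|U| = n -> #|W| = n ->
  ~ has_subdivision adj k.+2 -> ~ has_subdivision (fun w u => adj u w) k.+2 ->
  edge_count adj [set: U] [set: W] ^ k.*2.+1 <=
    (64 * k.+2 * 'C(k.+2, 2)) ^ k.+3.*2 * n ^ (3 * k).+1.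
Proof.
move=> k0 cU cW freeU freeW; set G := 64 * _ * _; set e0 := edge_count _ _ _.
rewrite leqNgt; apply/negP => dense.
have e00 : 0 < e0 by case: e0 dense => //; rewrite exp0n.
have nU : [set: U] != set0.
  by apply: contraTneq e00; rewrite /e0 => ->; rewrite /edge_count big_set0.
have nW : [set: W] != set0.
  by apply: contraTneq e00; rewrite /e0 => ->; rewrite edge_countC big_set0.
have [A [B [nA nB ext]]] := extremal_pair_exists adj k nU nW.
have denseAB : G ^ k.+3.*2 * pair_weight k A B <= edge_count adj A B ^ k.*2.+1.
  have := ext _ _ nU nW; rewrite -/e0.
  have -> : pair_weight k [set: U] [set: W] = n ^ (3 * k).+1.
    by rewrite /pair_weight !cardsT cU cW minnn maxnn -expnD; congr (_ ^ _); lia.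
  have n0 : 0 < n ^ (3 * k).+1 by rewrite expn_gt0 -cU -cardsT card_gt0 nU.
  move=> le; rewrite -(leq_pmul2r n0); apply: leq_trans le.
  by rewrite mulnAC leq_mul2r (ltnW dense) orbT.
have eAB : 0 < edge_count adj A B.
  rewrite lt0n; apply: contraTneq denseAB => ->; rewrite exp0n // -ltnNge muln_gt0.
  by rewrite pair_weight_gt0 // expn_gt0 /G !muln_gt0 bin_gt0.
case: (leqP #|A| #|B|) => [AB|/ltnW AB].
  apply: (extremal_has_subdivision k0 ext) => //.
  by move: denseAB; rewrite /pair_weight (minn_idPl AB) (maxn_idPr AB).
have ecT A' B' : edge_count (fun w u => adj u w) B' A' = edge_count adj A' B'.
  by rewrite edge_countC.
apply: (@extremal_has_subdivision _ _ (fun w u => adj u w) k B A) => //.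
- move=> B' A' nB' nA'; rewrite !ecT /pair_weight.
  by rewrite (minnC #|B|) (maxnC #|B|) (minnC #|B'|) (maxnC #|B'|); apply: ext.
- by rewrite ecT.
- by move: denseAB; rewrite ecT /pair_weight (minn_idPr AB) (maxn_idPl AB).
Qed.

Lemma pair_with t (i : 'I_t) : 1 < t -> exists e : pair_of t, i \in val e.
Proof.
move=> t1; have [j ji] : exists j, j != i.
  have /card_gt0P[j] : 0 < #|[set~ i]| by rewrite cardsC1 card_ord; lia.
  by rewrite !inE => ji; exists j.
have ij : #|[set i; j]| == 2 by rewrite cards2 (eq_sym i) ji.
by exists (exist (fun e : {set _} => #|e| == 2) _ ij); rewrite !inE eqxx.
Qed.

Lemma pair_elt t (e : pair_of t) : exists i, i \in val e.
Proof.
by apply/set0Pn; rewrite -card_gt0 (eqP (valP e : #|val e| == 2)).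
Qed.

Lemma card_subdivision_free n k (E : {set {set 'I_n}}) :
  0 < k -> E \subset clique_edges [set: 'I_n] ->
  ~~ contains_copy E (subdivided_clique k.+2) ->
  #|E| ^ k.*2.+1 <=
    4 ^ k.*2.+1 * (64 * k.+2 * 'C(k.+2, 2)) ^ k.+3.*2 * n ^ (3 * k).+1.
Proof.
move=> k0 Esub free.
pose Q : {set 'I_n * 'I_n} := [set z | [set z.1; z.2] \in E].
pose p (z : 'I_n * 'I_n) (i : 'I_2) := if i == ord0 then z.1 else z.2.
have E2 s : s \in E -> #|s| == 2 by move/(subsetP Esub); rewrite inE => /andP[].
have pinj : {in Q, forall z, injective (p z)}.
  move=> z; rewrite inE => /E2; rewrite cards2 eqSS eqb1 => z12 i j.
  rewrite /p; case: eqP => [->|/eqP i0]; case: eqP => [->|/eqP j0] //.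
  - by move=> h; rewrite h eqxx in z12.
  - by move=> h; rewrite h eqxx in z12.
  - by move=> _; apply: val_inj; move: i0 j0; case: i j => [[|[|?]] ?] [[|[|?]] ?].
(* At least a quarter of the ordered edges run from label 0 to label 1, whence the factor 4. *)
have [f fbig] := exists_good_labeling pinj.
have EQ : #|E| <= #|Q|.
  apply: (@leq_trans #|[set [set z.1; z.2] | z in Q]|); last exact: leq_imset_card.
  apply/subset_leq_card/subsetP => s sE.
  have /cards2P[u [v [_ suv]]] := E2 _ sE.
  by apply/imsetP; exists (u, v); rewrite ?inE -suv.
pose adj u v := [&& [set u; v] \in E, f u == ord0 & f v != ord0].
have cadj : #|[set z in Q | [forall i, f (p z i) == i]]| <=
    edge_count adj [set: 'I_n] [set: 'I_n].
  rewrite /edge_count (eq_bigr (fun u => \sum_(v in [set: 'I_n]) adj u v)); last first.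
    by move=> u _; rewrite card_setId_sum.
  rewrite pair_big /= -sum1_card big_mkcond [X in _ <= X]big_mkcond /=.
  apply: leq_sum => z _; rewrite !inE /adj; case: (_ \in E) => //=.
  case: forallP => // h; have := h ord0; have := h ord_max.
  by rewrite /p /= => /eqP-> ->.
have le : edge_count adj [set: 'I_n] [set: 'I_n] ^ k.*2.+1 <=
    (64 * k.+2 * 'C(k.+2, 2)) ^ k.+3.*2 * n ^ (3 * k).+1.
  apply: subdivision_free_bipartite; rewrite ?card_ord //.
  - move=> [x [y [xinj yinj xy]]]; case/negP: free.
    apply: (contains_subdivided_clique (L := [set v | f v == ord0]) xinj yinj).
    + move=> i; have [e ie] := pair_with i (isT : 1 < k.+2).
      by have := xy _ _ ie; rewrite inE => /and3P[].
    + move=> e; have [i ie] := pair_elt e.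
      by have := xy _ _ ie; rewrite inE => /and3P[].
    + by move=> i e ie; have := xy _ _ ie => /and3P[].
  - move=> [x [y [xinj yinj xy]]]; case/negP: free.
    apply: (contains_subdivided_clique (L := [set v | f v != ord0]) xinj yinj).
    + move=> i; have [e ie] := pair_with i (isT : 1 < k.+2).
      by have := xy _ _ ie; rewrite inE => /and3P[].
    + move=> e; have [i ie] := pair_elt e.
      by have := xy _ _ ie; rewrite inE negbK => /and3P[].
    + by move=> i e ie; have := xy _ _ ie; rewrite setUC => /and3P[].
rewrite -mulnA; apply: leq_trans (leq_mul (leqnn (4 ^ k.*2.+1)) le).
rewrite -expnMn leq_exp2r //; apply: leq_trans (leq_trans EQ fbig) _.
by rewrite leq_mul2l cadj.
Qed.

(** * Repeated colors and the auxiliary graph *)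

Lemma leq_card_inj_in (T T' : finType) (h : T -> T') (A : {set T}) (B : {set T'}) :
  {in A &, injective h} -> {in A, forall x, h x \in B} -> #|A| <= #|B|.
Proof.
move=> hinj hB; rewrite -(card_in_imset hinj).
by apply/subset_leq_card/subsetP => _ /imsetP[x xA ->]; apply: hB.
Qed.

Lemma leq_card_fibers (T T' : finType) (g : T -> T') (S : {set T}) (P : {set T'}) d :
  {in S, forall z, g z \in P} ->
  {in P, forall x, #|[set z in S | g z == x]| <= d} -> #|S| <= #|P| * d.
Proof.
move=> gP fib; rewrite -sum1_card (partition_big g (mem P)) //= -sum_nat_const.
apply: leq_sum => x xP; apply: leq_trans (fib x xP).
by rewrite -sum1_card leq_eqVlt; apply/orP; left; apply/eqP; apply: eq_bigl => z;
  rewrite inE.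
Qed.

(** Cauchy-Schwarz over the color classes; the ordered pairs counted include the diagonal. *)
Lemma card_same_color (T : finType) (P : {set T}) (f : T -> nat) :
  #|P| ^ 2 <= size (undup [seq f x | x in P]) *
    #|[set z : T * T | [&& z.1 \in P, z.2 \in P & f z.1 == f z.2]]|.
Proof.
set r := undup _.
have fr x : x \in P -> f x \in r.
  by move=> xP; rewrite mem_undup; apply: image_f.
have ru : uniq r by apply: undup_uniq.
have sum_eq (a : T) : a \in P -> \sum_(i <- r) (f a == i) = 1.
  move=> aP; rewrite (bigD1_seq (f a)) ?fr //= eqxx big1 // => i.
  by rewrite eq_sym => /negPf->.
have := sum_sqr_seq r (fun i => \sum_(x in P) (f x == i)).
have -> : \sum_(i <- r) \sum_(x in P) (f x == i) = #|P|.
  by rewrite exchange_big /= -sum1_card; apply: eq_bigr => x /sum_eq.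
move/leq_trans; apply; rewrite leq_mul2l; apply/orP; right.
have -> : #|[set z : T * T | [&& z.1 \in P, z.2 \in P & f z.1 == f z.2]]| =
    \sum_(x in P) \sum_(y in P) (f x == f y).
  rewrite pair_big /= -sum1_card big_mkcond [RHS]big_mkcond /=.
  by apply: eq_bigr => z _; rewrite inE andbA; case: (_ && (z.2 \in P)) => //=; case: eqP.
rewrite (eq_bigr (fun i => \sum_(x in P) \sum_(y in P) (f x == i) * (f y == i))).
  rewrite exchange_big /=; apply: leq_sum => x xP.
  rewrite exchange_big /=; apply: leq_sum => y yP.
  rewrite (bigD1_seq (f x)) ?fr //= eqxx mul1n eq_sym big1 ?addn0 // => i.
  by rewrite eq_sym => /negPf->.
move=> i _; rewrite expnS expn1 big_distrl /=; apply: eq_bigr => x _.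
by rewrite big_distrr.
Qed.

(** A maximal independent set dominates [S], and each of its elements dominates at most [d]
    elements, itself included. *)
Lemma independent_subset (T : finType) (r : rel T) (S : {set T}) d :
  symmetric r -> reflexive r -> {in S, forall x, #|[set y in S | r x y]| <= d} ->
  exists I : {set T}, [/\ I \subset S, {in I &, forall x y, r x y -> x = y} &
    #|S| <= #|I| * d].
Proof.
move=> rs rr deg.
pose P (I : {set T}) := (I \subset S) && [forall x in I, forall y in I, r x y ==> (x == y)].
have P0 : P set0 by rewrite /P sub0set; apply/forallP => x; rewrite inE.
case: (@arg_maxnP _ set0 P (fun I => #|I|) P0) => I /andP[IS /forallP Iind] Imax.
have {}Iind : {in I &, forall x y, r x y -> x = y}.
  move=> x y xI yI rxy; have := Iind x; rewrite xI => /forallP/(_ y).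
  by rewrite yI rxy => /eqP.
exists I; split=> //.
have dom y : y \in S -> exists2 x, x \in I & r x y.
  move=> yS; case: (boolP [exists x in I, r x y]) => [/existsP[x /andP[]]|no].
    by exists x.
  have nox x : x \in I -> r x y = false.
    by move=> xI; apply: contraNF no => rxy; apply/existsP; exists x; rewrite xI.
  have yI : y \notin I by apply/negP => /nox; rewrite rr.
  have : P (y |: I).
    rewrite /P subUset sub1set yS IS /=; apply/forallP => a; apply/implyP => aI.
    apply/forallP => b; apply/implyP => bI; apply/implyP => rab; apply/eqP.
    move: aI bI; rewrite !inE => /predU1P[ay|aI] /predU1P[yb|bI].
    + by rewrite ay yb.
    + by rewrite ay rs nox in rab.
    + by rewrite yb nox in rab.
    + exact: Iind.
  by move/Imax; rewrite cardsU1 yI /= add1n ltnn.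
apply: (@leq_trans #|\bigcup_(x in I) [set y in S | r x y]|).
  apply/subset_leq_card/subsetP => y yS; have [x xI rxy] := dom y yS.
  by apply/bigcupP; exists x; rewrite // inE yS.
apply: (@leq_trans (\sum_(x in I) #|[set y in S | r x y]|)).
  apply: (big_ind2 (fun (X : {set T}) n => #|X| <= n)); rewrite ?cards0 //.
  move=> X a Y b Xa Yb; apply: leq_trans (leq_card_setU _ _).1 _; exact: leq_add.
by rewrite -sum_nat_const; apply: leq_sum => x xI; apply/deg/(subsetP IS).
Qed.

Lemma card_clique_edges (T : finType) (A : {set T}) : #|clique_edges A| = 'C(#|A|, 2).
Proof. by rewrite -cards_draws. Qed.

Lemma clique_edgesS (T : finType) (A B : {set T}) :
  A \subset B -> clique_edges A \subset clique_edges B.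
Proof.
by move=> AB; apply/subsetP => e; rewrite !inE => /andP[eA ->]; rewrite (subset_trans eA).
Qed.

Lemma exists_superset_card (T : finType) (A : {set T}) p :
  #|A| <= p <= #|T| -> exists2 B : {set T}, A \subset B & #|B| = p.
Proof.
case/andP=> Ap pT.
have : 0 < #|[set X : {set T} | X \subset ~: A & #|X| == p - #|A|]|.
  by rewrite cards_draws bin_gt0; have := cardsC A; lia.
case/card_gt0P => X; rewrite inE => /andP[XA /eqP cX].
exists (A :|: X); first exact: subsetUl.
rewrite cardsU cX (_ : A :&: X = set0) ?cards0; first by lia.
by apply/eqP; rewrite setI_eq0 disjoint_sym disjoints_subset.
Qed.

(** * Sets of edges with repeated colors *)

Section Repeats.
Variables (T : finType) (c : {set T} -> nat) (p m : nat).
Hypothesis rich : forall A : {set T}, #|A| = p -> 'C(p, 2) < ncolors c A + m.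
Hypothesis pT : p <= #|T|.

(** Deleting [r] from the clique on [A] loses no color, so [#|r|] edges are wasted. *)
Definition repeated (A : {set T}) (r : {set {set T}}) : Prop :=
  r \subset clique_edges A /\
  {in r, forall e, exists2 e', e' \in clique_edges A :\: r & c e' = c e}.

Lemma ncolors_repeated A r : repeated A r -> ncolors c A + #|r| <= 'C(#|A|, 2).
Proof.
case=> rA rep; rewrite -card_clique_edges -(subnK (subset_leq_card rA)).
rewrite -cardsDS // leq_add2r /ncolors -(size_image c (mem (clique_edges A :\: r))).
apply: uniq_leq_size; first exact: undup_uniq.
move=> i; rewrite mem_undup => /imageP[e eA ->].
case: (boolP (e \in r)) => [/rep[e' e'A <-]|er]; first exact: image_f.
by apply: image_f; rewrite inE er.
Qed.

(** A set smaller than [p] is padded with arbitrary vertices, and the repetitions survive. This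
    admits copies whose coordinates coincide. *)
Lemma card_repeated_lt (A : {set T}) r : #|A| <= p -> repeated A r -> #|r| < m.
Proof.
move=> Ap [rA rep]; have [|B AB Bp] := @exists_superset_card _ A p.
  by rewrite Ap.
have : repeated B r.
  split=> [|e /rep[e' /setDP[e'A e'r] ce]]; first exact: subset_trans (clique_edgesS AB).
  by exists e' => //; rewrite inE e'r (subsetP (clique_edgesS AB)).
by move/ncolors_repeated; have := rich Bp; rewrite Bp; lia.
Qed.

Hypothesis mp : m.+2 <= p.

(** In a monochromatic star with [m.+1] edges, all edges but the one to [w0] are repeated, and the
    star has [m.+2 <= p] vertices. *)
Lemma card_color_neighbours v i :
  #|[set w | (w != v) && (c [set v; w] == i)]| <= m.
Proof.
set N := [set w | _]; rewrite leqNgt; apply/negP => big.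
have : 0 < #|[set X : {set T} | X \subset N & #|X| == m.+1]|.
  by rewrite cards_draws bin_gt0.
case/card_gt0P => X; rewrite inE => /andP[XN /eqP cX].
have /card_gt0P[w0 w0X] : 0 < #|X| by rewrite cX.
have XP w : w \in X -> w != v /\ c [set v; w] = i.
  by move/(subsetP XN); rewrite inE => /andP[? /eqP].
pose r := [set [set v; w] | w in X :\ w0].
have inj : {in X &, injective (fun w => [set v; w])}.
  move=> w w' wX w'X /setP/(_ w); rewrite !inE eqxx orbT.
  by have [/negPf-> _] := XP w wX => /esym/eqP.
have cr : #|r| = m.
  rewrite card_in_imset; last by move=> a b /setD1P[_ ?] /setD1P[_ ?]; apply: inj.
  by have := cardsD1 w0 X; rewrite w0X cX add1n => -[].
have vw w : w \in X -> [set v; w] \in clique_edges (v |: X).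
  move=> wX; rewrite inE subUset !sub1set setU11 (setU1r _ wX) /= cards2 (eq_sym v).
  by have [-> _] := XP w wX.
suff : #|r| < m by rewrite cr ltnn.
apply: (@card_repeated_lt (v |: X)).
  by rewrite cardsU1 cX; case: (v \in X) => /=; lia.
split; first by apply/subsetP => _ /imsetP[w /setD1P[_ wX] ->]; apply: vw.
move=> _ /imsetP[w /setD1P[ww0 wX] ->]; exists [set v; w0].
  rewrite inE vw // andbT; apply/negP => /imsetP[w' /setD1P[w'w0 w'X] /inj].
  by move=> /(_ w0X w'X) ww; rewrite ww eqxx in w'w0.
by have [_ ->] := XP _ w0X; have [_ ->] := XP _ wX.
Qed.

End Repeats.

Lemma card_incidences t :
  #|[set ve : 'I_t * pair_of t | ve.1 \in val ve.2]| = 2 * 'C(t, 2).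
Proof.
transitivity (\sum_(e : pair_of t) \sum_(i : 'I_t) (i \in val e)).
  rewrite exchange_big pair_big -sum1_card big_mkcond /=.
  by apply: eq_bigr => ve _; rewrite inE; case: (_ \in _).
rewrite (eq_bigr (fun=> 2)) => [|e _].
  by rewrite sum_nat_const card_pairs_ord mulnC.
apply: etrans (eqP (valP e : #|val e| == 2)); rewrite -sum1_card [RHS]big_mkcond /=.
by apply: eq_bigr => i _; case: (_ \in _).
Qed.

(** * Copies of [K_t^+] in the auxiliary graph *)

Section Parallel.
Variables (T : finType) (c : {set T} -> nat) (t : nat).
Let p := 2 * (t + 'C(t, 2)).
Let m := 2 * 'C(t, 2).
Hypothesis rich : forall A : {set T}, #|A| = p -> 'C(p, 2) < ncolors c A + m.
Hypothesis pT : p <= #|T|.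
Hypothesis t1 : 1 < t.

(* [((a, a'), (b, b'))] stands for the edge joining [(a, b)] to [(a', b')] in the
   auxiliary graph on [T * T]. *)
Definition parallel (f : T -> 'I_4) (l1 l2 l3 l4 : 'I_4)
    (I : {set (T * T) * (T * T)}) : Prop :=
  [/\ uniq [:: l1; l2; l3; l4],
      {in I, forall z, c [set z.1.1; z.1.2] = c [set z.2.1; z.2.2]},
      {in I, forall z, [/\ f z.1.1 = l1, f z.1.2 = l2, f z.2.1 = l3 & f z.2.2 = l4]} &
      {in I &, forall z z', z.2 = z'.2 -> z.1.1 = z'.1.1 \/ z.1.2 = z'.1.2 -> z = z'}].

(** The edges formed by second coordinates repeat the colors of those formed by first coordinates,
    and the labels keep the two families apart. Injectivity of [h] makes [m] repeated edges, on at
    most [p] vertices. *)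
Lemma parallel_no_subdivision f l1 l2 l3 l4 I (x : 'I_t -> T * T)
    (y : pair_of t -> T * T) :
  parallel f l1 l2 l3 l4 I -> injective x -> injective y ->
  (forall i (e : pair_of t), i \in val e ->
     (((x i).1, (y e).1), ((x i).2, (y e).2)) \in I) -> False.
Proof.
case=> ul cI lI confI xinj yinj xyI.
have xl i : f (x i).1 = l1 /\ f (x i).2 = l3.
  by have [e /xyI/lI[]] := pair_with i t1.
have yl e : f (y e).1 = l2 /\ f (y e).2 = l4.
  by have [i /xyI/lI[]] := pair_elt e.
have [l12 l13 l34 l14] : [/\ l1 != l2, l1 != l3, l3 != l4 & l1 != l4].
  by move: ul; rewrite /= !inE !negb_or => /and4P[/and3P[-> -> ->] _ ->].
pose X := [set ve : 'I_t * pair_of t | ve.1 \in val ve.2].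
pose h (ve : 'I_t * pair_of t) := [set (x ve.1).2; (y ve.2).2].
pose A : {set T} := ([set (x i).1 | i : 'I_t] :|: [set (y e).1 | e : pair_of t]) :|:
    ([set (x i).2 | i : 'I_t] :|: [set (y e).2 | e : pair_of t]).
have cA : #|A| <= p.
  rewrite /p mul2n -addnn.
  apply: leq_trans (leq_card_setU _ _).1 (leq_add _ _);
    apply: leq_trans (leq_card_setU _ _).1 (leq_add _ _);
    by apply: leq_trans (leq_imset_card _ _) _; rewrite ?cardT -?cardE ?card_ord ?card_pairs_ord.
have Ax1 i : (x i).1 \in A by apply/setUP; left; apply/setUP; left; apply/imsetP; exists i.
have Ay1 e : (y e).1 \in A by apply/setUP; left; apply/setUP; right; apply/imsetP; exists e.
have Ax2 i : (x i).2 \in A by apply/setUP; right; apply/setUP; left; apply/imsetP; exists i.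
have Ay2 e : (y e).2 \in A by apply/setUP; right; apply/setUP; right; apply/imsetP; exists e.
have hinj : {in X &, injective h}.
  move=> [i e] [j e']; rewrite !inE /= => ie je' /setP hh.
  have x2 : (x i).2 = (x j).2.
    have := hh (x i).2; rewrite !inE eqxx /= => /esym/orP[/eqP //|/eqP h2].
    by have [_ a] := xl i; have [_ b] := yl e'; rewrite -a -b h2 eqxx in l34.
  have y2 : (y e).2 = (y e').2.
    have := hh (y e).2; rewrite !inE eqxx orbT /= => /esym/orP[/eqP h2|/eqP //].
    by have [_ a] := xl j; have [_ b] := yl e; rewrite -a -b h2 eqxx in l34.
  have ij : i = j.
    apply/eqP; apply: contraT => ij.
    (* The vertex subdividing the pair of [i] and [j] is a common neighbour of [x i] and [x j], so
       equal second coordinates give two members of [I] that [confI] identifies. Below, [x i] plays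
       this role for [y e] and [y e']. *)
    have e0P : #|[set i; j]| == 2 by rewrite cards2 ij.
    pose e0 : pair_of t := exist (fun e : {set _} => #|e| == 2) _ e0P.
    have i0 : i \in val e0 by rewrite !inE eqxx.
    have j0 : j \in val e0 by rewrite !inE eqxx orbT.
    have [x1 _] : (((x i).1, (y e0).1), ((x i).2, (y e0).2)) =
                  (((x j).1, (y e0).1), ((x j).2, (y e0).2)).
      by apply: (confI _ _ (xyI _ _ i0) (xyI _ _ j0)); [rewrite /= x2|right].
    have : x i = x j by rewrite (surjective_pairing (x i)) x1 x2 -surjective_pairing.
    by move/xinj/eqP; rewrite (negPf ij).
  move: je'; rewrite -ij => ie'.
  have [y1 _] : (((x i).1, (y e).1), ((x i).2, (y e).2)) =
                (((x i).1, (y e').1), ((x i).2, (y e').2)).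
    by apply: (confI _ _ (xyI _ _ ie) (xyI _ _ ie')); [rewrite /= y2|left].
  by rewrite (yinj e e') // (surjective_pairing (y e)) y1 y2 -surjective_pairing.
suff : #|h @: X| < m by rewrite card_in_imset // card_incidences ltnn.
apply: (card_repeated_lt rich pT cA); split.
  apply/subsetP => _ /imsetP[[i e] _ ->]; rewrite /h inE cards2 /=.
  have -> : (x i).2 != (y e).2.
    apply: contraNneq l34 => xy; have [_ <-] := xl i; have [_ <-] := yl e.
    by rewrite xy.
  by rewrite subUset !sub1set Ax2 Ay2.
move=> _ /imsetP[[i e] + ->]; rewrite inE /= => ie.
exists [set (x i).1; (y e).1]; last exact: (cI _ (xyI _ _ ie)).
have xy : (x i).1 != (y e).1.
  apply: contraNneq l12 => xy; have [<- _] := xl i; have [<- _] := yl e.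
  by rewrite xy.
apply/setDP; split; first by rewrite inE cards2 xy subUset !sub1set Ax1 Ay1.
apply/negP => /imsetP[[j e'] _ /setP/(_ (x i).1)]; rewrite !inE eqxx /=.
have [a _] := xl i; have [_ b] := xl j; have [_ d] := yl e'.
move/esym/orP => -[] /eqP eq.
  by rewrite -a -b eq eqxx in l13.
by rewrite -a -d eq eqxx in l14.
Qed.

(** [enum_rank] turns [I] into an undirected graph on [#|T * T|] vertices. The label of a first
    coordinate tells sources from targets and so restores the forgotten orientation. *)
Lemma card_parallel_le_turan f l1 l2 l3 l4 I :
  parallel f l1 l2 l3 l4 I ->
  #|I| <= turan #|{: T * T}| (subdivided_clique t).
Proof.
move=> parI; have [ul cI lI confI] := parI.
have [l12 l34] : l1 != l2 /\ l3 != l4.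
  by move: ul; rewrite /= !inE !negb_or => /and4P[/and3P[-> _ _] _ ->].
pose src (z : (T * T) * (T * T)) := (z.1.1, z.2.1).
pose tgt (z : (T * T) * (T * T)) := (z.1.2, z.2.2).
pose h z := [set enum_rank (src z); enum_rank (tgt z)].
have srctgt z z' : z \in I -> z' \in I -> src z != tgt z'.
  move=> /lI[a _ _ _] /lI[_ b _ _]; apply: contraNneq l12 => -[st _].
  by rewrite -a -b st.
have hinj : {in I &, injective h}.
  move=> z z' zI z'I /setP hh.
  have := hh (enum_rank (src z)); rewrite !inE eqxx /= !(inj_eq enum_rank_inj).
  rewrite (negPf (srctgt _ _ zI z'I)) orbF => /esym/eqP[a b].
  have := hh (enum_rank (tgt z)); rewrite !inE eqxx orbT /= !(inj_eq enum_rank_inj).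
  rewrite eq_sym (negPf (srctgt _ _ z'I zI)) /= => /esym/eqP[a' b'].
  by case: z z' a b a' b' {zI z'I hh} => [[? ?] [? ?]] [[? ?] [? ?]] /= -> -> -> ->.
rewrite -(card_in_imset hinj).
apply: (@leq_bigmax_cond _ _ (fun E : {set {set _}} => #|E|)); apply/andP; split.
  apply/subsetP => _ /imsetP[z zI ->]; rewrite inE subsetT cards2.
  by rewrite (inj_eq enum_rank_inj) srctgt.
apply/negP => /existsP[g /andP[/injectiveP ginj /forallP gE]].
pose x (i : 'I_t) : T * T := enum_val (g (inl i : subdivided_clique t)).
pose y (e : pair_of t) : T * T := enum_val (g (inr e : subdivided_clique t)).
have xinj : injective x by move=> i j /enum_val_inj/ginj[].
have yinj : injective y by move=> i j /enum_val_inj/ginj[].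
have xyE i (e : pair_of t) : i \in val e -> exists2 z, z \in I &
    (src z = x i /\ tgt z = y e) \/ (src z = y e /\ tgt z = x i).
  move=> ie; have := gE [set inl i; inr e]; rewrite (_ : _ \in _ = true); last first.
    by apply/imsetP; exists (i, e); rewrite ?inE.
  rewrite imsetU !imset_set1 => /imsetP[z zI /setP hh]; exists z => //.
  have xE : g (inl i : subdivided_clique t) = enum_rank (x i) by rewrite enum_valK.
  have yE : g (inr e : subdivided_clique t) = enum_rank (y e) by rewrite enum_valK.
  have := hh (enum_rank (src z)); have := hh (enum_rank (tgt z)).
  rewrite !inE !eqxx orbT /= xE yE !(inj_eq enum_rank_inj).
  have st := srctgt _ _ zI zI.
  move=> /orP[]/eqP tz /orP[]/eqP sz; [|by right|by left|];
    by move: st; rewrite sz tz eqxx.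
have lsrc z : z \in I -> f (src z).1 == l1 by case/lI => /eqP.
have ltgt z : z \in I -> f (tgt z).1 != l1.
  by case/lI => _ b _ _; rewrite /= b eq_sym.
(* Two branch vertices share a subdividing neighbour and every edge joins a source to a target, so
   all branch vertices are on one side. *)
have side i j (e : pair_of t) : i \in val e -> j \in val e ->
    f (x i).1 == l1 -> f (x j).1 == l1.
  move=> /xyE[z zI zE] /xyE[z' z'I z'E] si.
  case: zE => -[sz tz]; last by have := ltgt z zI; rewrite tz si.
  case: z'E => -[sz' tz']; first by rewrite -sz' lsrc.
  by have := ltgt z zI; rewrite tz -sz' lsrc.
case: (boolP [forall i, f (x i).1 == l1]) => [/forallP all1|].
  apply: (parallel_no_subdivision parI xinj yinj) => i e /xyE[z zI [[<- <-]|[sz tz]]].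
    by case: z zI => [[? ?] [? ?]].
  by have := ltgt z zI; rewrite tz all1.
rewrite negb_forall => /existsP[j0 nj0].
have all2 i : f (x i).1 != l1.
  have [->//|ij] := eqVneq i j0.
  have e0P : #|[set i; j0]| == 2 by rewrite cards2 ij.
  pose e0 : pair_of t := exist (fun e : {set _} => #|e| == 2) _ e0P.
  by apply: contra nj0; apply: (side _ _ e0); rewrite !inE eqxx ?orbT.
(* When the branch vertices are targets, reversing both arcs of every pair makes them sources. *)
pose J := [set z : (T * T) * (T * T) | ((z.1.2, z.1.1), (z.2.2, z.2.1)) \in I].
have parJ : parallel f l2 l1 l4 l3 J.
  split.
  - by rewrite -(perm_uniq (s1 := [:: l1; l2; l3; l4])) //; apply/permP => a /=; lia.
  - by move=> z; rewrite inE => /cI /=; rewrite setUC [in RHS]setUC.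
  - by move=> z; rewrite inE => /lI[].
  - move=> [[a a'] [b b']] [[d d'] [r r']]; rewrite !inE /= => zI z'I [bE b'E] or.
    have [] // : (a', a, (b', b)) = (d', d, (r', r)).
      by apply: (confI _ _ zI z'I) => /=; [rewrite bE b'E|case: or; auto].
    by move=> -> -> -> ->.
apply: (parallel_no_subdivision parJ xinj yinj) => i e /xyE[z zI [[sz tz]|[<- <-]]].
  by have := lsrc z zI; rewrite sz (negPf (all2 i)).
by rewrite inE /=; case: z zI => [[? ?] [? ?]].
Qed.
End Parallel.

From mathcomp Require Import boolp.

(** * Counting pairs of edges of equal color *)

Section Energy.
Variables (T : finType) (c : {set T} -> nat) (t : nat).
Let p := 2 * (t + 'C(t, 2)).
Let m := 2 * 'C(t, 2).
Hypothesis rich : forall A : {set T}, #|A| = p -> 'C(p, 2) < ncolors c A + m.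
Hypothesis pT : p <= #|T|.
Hypothesis t1 : 1 < t.

Let mp : m.+2 <= p. Proof. rewrite /m /p; lia. Qed.
Let N v i := [set w | (w != v) && (c [set v; w] == i)].
Let cN v i : #|N v i| <= m. Proof. exact: (card_color_neighbours rich pT mp). Qed.

Definition arcs : {set T * T} := [set z | z.1 != z.2].
Let col (z : T * T) := c [set z.1; z.2].
Let same := [set z : (T * T) * (T * T) |
  [&& z.1 \in arcs, z.2 \in arcs & col z.1 == col z.2]].
Let Q := [set z in same | uniq [:: z.1.1; z.1.2; z.2.1; z.2.2]].

(** Given the first arc and the shared vertex, [h z] is joined to that vertex in the same color,
    which leaves at most [m] choices. *)
Let card_meeting (S : {set (T * T) * (T * T)}) (v : T * T -> T)
    (h : (T * T) * (T * T) -> T) :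
  S \subset same ->
  {in S, forall z, z.2 = (v z.1, h z) \/ z.2 = (h z, v z.1)} ->
  (forall x, {in [set z in S | z.1 == x] &, injective h}) ->
  #|S| <= #|arcs| * m.
Proof.
move=> Ssame zE hinj; apply: (@leq_card_fibers _ _ fst) => [z|x _].
  by move/(subsetP Ssame); rewrite inE => /and3P[].
apply: leq_trans (cN (v x) (col x)); apply: leq_card_inj_in (hinj x) _ => z.
rewrite inE => /andP[zS /eqP zx]; have := subsetP Ssame z zS.
rewrite !inE /col zx => /and3P[_ z2 /eqP->].
by have [zz|zz] := zE z zS; move: z2; rewrite zz zx /= ?(eq_sym (v x))
  ?(setUC [set h z]) => ->; rewrite eqxx.
Qed.

Let card_same : #|same| <= #|Q| + 4 * (#|arcs| * m).
Proof.
pose B1 := [set z in same | z.2.1 == z.1.1]; pose B2 := [set z in same | z.2.1 == z.1.2].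
pose B3 := [set z in same | z.2.2 == z.1.1]; pose B4 := [set z in same | z.2.2 == z.1.2].
have cB1 : #|B1| <= #|arcs| * m.
  apply: (card_meeting (v := fst) (h := fun z => z.2.2)).
  - by apply/subsetP => z /setIdP[].
  - by move=> [[a a'] [b b']] /setIdP[_ /eqP /= ->]; left.
  - move=> x [[a a'] [b b']] [[d d'] [r r']] /setIdP[/setIdP[_ /eqP /= ->] /eqP<-].
    by move=> /setIdP[/setIdP[_ /eqP /= ->] /eqP[-> ->]] ->.
have cB2 : #|B2| <= #|arcs| * m.
  apply: (card_meeting (v := snd) (h := fun z => z.2.2)).
  - by apply/subsetP => z /setIdP[].
  - by move=> [[a a'] [b b']] /setIdP[_ /eqP /= ->]; left.
  - move=> x [[a a'] [b b']] [[d d'] [r r']] /setIdP[/setIdP[_ /eqP /= ->] /eqP<-].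
    by move=> /setIdP[/setIdP[_ /eqP /= ->] /eqP[-> ->]] ->.
have cB3 : #|B3| <= #|arcs| * m.
  apply: (card_meeting (v := fst) (h := fun z => z.2.1)).
  - by apply/subsetP => z /setIdP[].
  - by move=> [[a a'] [b b']] /setIdP[_ /eqP /= ->]; right.
  - move=> x [[a a'] [b b']] [[d d'] [r r']] /setIdP[/setIdP[_ /eqP /= ->] /eqP<-].
    by move=> /setIdP[/setIdP[_ /eqP /= ->] /eqP[-> ->]] ->.
have cB4 : #|B4| <= #|arcs| * m.
  apply: (card_meeting (v := snd) (h := fun z => z.2.1)).
  - by apply/subsetP => z /setIdP[].
  - by move=> [[a a'] [b b']] /setIdP[_ /eqP /= ->]; right.
  - move=> x [[a a'] [b b']] [[d d'] [r r']] /setIdP[/setIdP[_ /eqP /= ->] /eqP<-].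
    by move=> /setIdP[/setIdP[_ /eqP /= ->] /eqP[-> ->]] ->.
have cover : same \subset Q :|: (B1 :|: B2 :|: (B3 :|: B4)).
  apply/subsetP => z zs; rewrite !in_setU.
  have inB P : (z \in [set z in same | P z]) = P z by rewrite inE zs.
  rewrite /Q /B1 /B2 /B3 /B4 !inB /=; move: zs; rewrite !inE !negb_or => /and3P[-> -> _].
  rewrite (eq_sym z.2.1 z.1.1) (eq_sym z.2.1 z.1.2) (eq_sym z.2.2 z.1.1).
  rewrite (eq_sym z.2.2 z.1.2).
  by do 4! case: (_ == _).
apply: leq_trans (subset_leq_card cover) _.
apply: leq_trans (leq_card_setU _ _).1 _; rewrite leq_add2l.
apply: leq_trans (leq_card_setU _ _).1 _.
have := (leq_card_setU B1 B2).1; have := (leq_card_setU B3 B4).1.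
lia.
Qed.

Let pos (z : (T * T) * (T * T)) : 'I_4 -> T :=
  tnth [tuple z.1.1; z.1.2; z.2.1; z.2.2].

(** [256 = 4 ^ 4] is the price of labeling four endpoints. Pairs related by [r] violate the last
    condition of [parallel] unless equal; the color degrees allow [m] of them for each shared
    endpoint, hence [2 * m]. *)
Let cQ : #|Q| <= 256 * (turan #|{: T * T}| (subdivided_clique t) * (2 * m)).
Proof.
have posinj : {in Q, forall z, injective (pos z)}.
  by move=> z; rewrite inE => /andP[_ uz]; apply/tuple_uniqP.
have [f fbig] := exists_good_labeling posinj.
apply: leq_trans fbig _; apply: leq_mul => //.
set S := [set z in Q | _].
have Ssame z : z \in S -> z \in same by rewrite inE => /andP[/setIdP[]].
pose r (z z' : (T * T) * (T * T)) :=
  (z.2 == z'.2) && ((z.1.1 == z'.1.1) || (z.1.2 == z'.1.2)).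
have rs : symmetric r.
  by move=> z z'; rewrite /r (eq_sym z.2) (eq_sym z.1.1) (eq_sym z.1.2).
have rr : reflexive r by move=> z; rewrite /r !eqxx.
have degr : {in S, forall z, #|[set z' in S | r z z']| <= 2 * m}.
  move=> z zS; rewrite mul2n -addnn.
  apply: leq_trans (leq_add (cN z.1.1 (col z.2)) (cN z.1.2 (col z.2))).
  apply: (@leq_trans (#|[set z' in S | (z.2 == z'.2) && (z.1.1 == z'.1.1)]| +
                      #|[set z' in S | (z.2 == z'.2) && (z.1.2 == z'.1.2)]|)).
    apply: leq_trans (leq_card_setU _ _).1; apply/subset_leq_card/subsetP => z'.
    by rewrite !in_setU !in_set => /andP[-> /andP[-> /orP[]->]]; rewrite ?orbT.
  apply: leq_add.
    apply: (@leq_card_inj_in _ _ (fun z' => z'.1.2)).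
      move=> [[a a'] [b b']] [[d d'] [e e']] /setIdP[_ /andP[/eqP /= e1 /eqP /= e2]].
      by move=> /setIdP[_ /andP[/eqP /= e3 /eqP /= e4]] /= e5; congruence.
    move=> z' /setIdP[/Ssame + /andP[/eqP-> /eqP->]].
    by rewrite !inE eq_sym => /and3P[-> _ /eqP<-]; rewrite eqxx.
  apply: (@leq_card_inj_in _ _ (fun z' => z'.1.1)).
    move=> [[a a'] [b b']] [[d d'] [e e']] /setIdP[_ /andP[/eqP /= e1 /eqP /= e2]].
    by move=> /setIdP[_ /andP[/eqP /= e3 /eqP /= e4]] /= e5; congruence.
  move=> z' /setIdP[/Ssame + /andP[/eqP-> /eqP->]].
  by rewrite !inE => /and3P[-> _ /eqP<-]; rewrite setUC eqxx.
have [I [IS Iind cI]] := independent_subset rs rr degr.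
apply: leq_trans cI _; rewrite leq_mul2r; apply/orP; right.
apply: (@card_parallel_le_turan _ c t rich pT t1 f (inord 0) (inord 1) (inord 2) (inord 3)).
split.
- by rewrite /= !inE -!val_eqE /= !inordK.
- by move=> z /(subsetP IS)/Ssame; rewrite inE => /and3P[_ _ /eqP].
- move=> z /(subsetP IS); rewrite inE => /andP[_ /forallP lz].
  by split; [have := lz (inord 0)|have := lz (inord 1)|have := lz (inord 2)|have := lz (inord 3)];
    rewrite /pos (tnth_nth z.1.1) inordK // => /eqP.
- move=> z z' zI z'I z2 z1; apply: Iind => //; rewrite /r z2 eqxx /=.
  by case: z1 => ->; rewrite eqxx ?orbT.
Qed.

Let card_arcs : #|T| ^ 2 <= #|arcs| + #|T|.
Proof.
have := cardsC arcs; rewrite card_prod -mulnn => <-; rewrite leq_add2l.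
rewrite -(cardsT T); apply: (@leq_card_inj_in _ _ fst) => //.
by move=> [a b] [d e]; rewrite !inE !negbK /= => /eqP-> /eqP-> ->.
Qed.

(** The hypothesis on [turan] absorbs the pairs of arcs that meet: [512 + 8 = 520]. A factor 4 from
    squaring [#|T| ^ 2 <= 2 * #|arcs|] makes [2080]. *)
Lemma color_turan_energy :
  #|T| ^ 2 <= 2 * turan (#|T| ^ 2) (subdivided_clique t) ->
  #|T| ^ 4 <= 2080 * m * (ncolors c [set: T] * turan (#|T| ^ 2) (subdivided_clique t)).
Proof.
have -> : #|T| ^ 2 = #|{: T * T}| by rewrite card_prod mulnn.
move: cQ; set tau := turan _ _ => cQ' large; rewrite card_prod mulnn in large.
have le1 := card_same_color arcs col.
have le2 : size (undup [seq col x | x in arcs]) <= ncolors c [set: T].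
  apply: uniq_leq_size; first exact: undup_uniq.
  move=> i; rewrite !mem_undup => /imageP[z zA ->].
  by apply: (image_f c); move: zA; rewrite !inE subsetT cards2 => ->.
have aT : #|arcs| <= #|T| ^ 2.
  by rewrite -mulnn -card_prod; apply: max_card.
have T2 : 2 <= #|T| by apply: leq_trans pT; rewrite /p; lia.
have a2 : #|T| ^ 2 <= 2 * #|arcs| by have := card_arcs; nia.
have a4 : #|T| ^ 4 <= 4 * #|arcs| ^ 2.
  by rewrite (expnM _ 2 2) -(expnMn 2 _ 2) leq_exp2r.
apply: leq_trans a4 _.
have le3 : #|same| <= 520 * m * tau.
  apply: leq_trans card_same _.
  have : #|arcs| * m <= 2 * tau * m by rewrite leq_mul2r (leq_trans aT) ?orbT.
  lia.
have := leq_trans le1 (leq_mul le2 le3).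
rewrite (_ : 2080 * m * _ = 4 * (ncolors c [set: T] * (520 * m * tau))); last by ring.
by rewrite leq_pmul2l.
Qed.

End Energy.

Lemma card_subdivided_clique t : #|subdivided_clique t| = t + 'C(t, 2).
Proof. by rewrite /= card_sum card_ord card_pairs_ord. Qed.

Lemma card_subdivided_clique_edges t : #|edges (subdivided_clique t)| = 2 * 'C(t, 2).
Proof.
rewrite -card_incidences /= /subdiv_edges card_in_imset //.
move=> [i e] [j e'] _ _ /setP h; have := h (inl i); have := h (inr e).
by rewrite !inE !eqxx /= orbF => /esym/eqP[->] /esym/eqP[->].
Qed.

(* A star contains no two disjoint edges. *)
Lemma turan_subdivided_clique_ge n t : 2 < t -> n.-1 <= turan n (subdivided_clique t).
Proof.
move=> t2; case: n => // n /=; pose E := [set [set ord0; v] | v in [set~ (ord0 : 'I_n.+1)]].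
have cE : #|E| = n.
  rewrite card_in_imset ?cardsC1 ?card_ord // => u v; rewrite !inE => u0 v0 /setP/(_ u).
  by rewrite !inE eqxx orbT (negPf u0) => /esym/eqP.
rewrite -{1}cE.
apply: (@leq_bigmax_cond _ _ (fun E : {set {set _}} => #|E|)); apply/andP; split.
  apply/subsetP => _ /imsetP[v v0 ->]; rewrite !inE subsetT cards2 (eq_sym ord0).
  by move: v0; rewrite !inE => ->.
apply/negP => /existsP[g /andP[/injectiveP ginj /forallP gE]].
have hit i (e : pair_of t) : i \in val e ->
    (g (inl i : subdivided_clique t) == ord0) || (g (inr e : subdivided_clique t) == ord0).
  move=> ie; have := gE [set inl i; inr e]; rewrite (_ : _ \in _ = true); last first.
    by apply/imsetP; exists (i, e); rewrite ?inE.
  rewrite imsetU !imset_set1 => /imsetP[v _ /setP/(_ ord0)].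
  by rewrite !inE eqxx /= ![ord0 == _]eq_sym.
pose o0 : 'I_t := Ordinal (ltnW (ltnW t2)); pose o1 : 'I_t := Ordinal (ltnW t2).
pose o2 : 'I_t := Ordinal t2.
have e01P : #|[set o0; o1]| == 2 by rewrite cards2.
have e12P : #|[set o1; o2]| == 2 by rewrite cards2.
pose e01 : pair_of t := exist (fun e : {set _} => #|e| == 2) _ e01P.
pose e12 : pair_of t := exist (fun e : {set _} => #|e| == 2) _ e12P.
have i0 : o0 \in val e01 by rewrite !inE eqxx.
have i1 : o1 \in val e12 by rewrite !inE eqxx.
have ne : e01 != e12.
  by apply/eqP => /(congr1 val)/setP/(_ o0); rewrite /= !inE.
clearbody e01 e12; case/eqP: ne.
by case/orP: (hit _ _ i0) => /eqP a; case/orP: (hit _ _ i1) => /eqP b;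
  have := ginj _ _ (etrans a (esym b)) => -[].
Qed.

(** Coloring by [enum_rank] is rainbow, so the default value in [erdos_gyarfas] is not taken. *)
Lemma erdos_gyarfasP n p q : 0 < 'C(p, 2) -> q <= 'C(p, 2) ->
  pq_colorable_with n p q (erdos_gyarfas n p q).
Proof.
move=> p0 qp; rewrite /erdos_gyarfas; case: pselect => [h|[]].
  by case: ex_minnP => k /asboolP.
exists (ncolors (fun e : {set 'I_n} => enum_rank e : nat) [set: 'I_n]).
exists (fun e : {set 'I_n} => enum_rank e : nat) => // A Ap.
rewrite /ncolors undup_id ?size_image ?card_clique_edges ?Ap //.
rewrite map_inj_uniq ?enum_uniq // => e e' /val_inj; exact: enum_rank_inj.
Qed.

(** This is [color_turan_energy] for an optimal coloring, with [m = 2 * 'C(t, 2)] and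
    [4160 = 2 * 2080]; the star bound on [turan] supplies its hypothesis. *)
Lemma erdos_gyarfas_turan n t (s := #|subdivided_clique t|) : 2 < t -> 2 * s <= n ->
  n ^ 4 <= 4160 * 'C(t, 2) *
    (erdos_gyarfas n (2 * s) ('C(2 * s, 2) - #|edges (subdivided_clique t)| + 1) *
     turan (n ^ 2) (subdivided_clique t)).
Proof.
move=> t2; rewrite /s card_subdivided_clique card_subdivided_clique_edges => sn.
set q := 'C(_, 2) - _ + 1; set eg := erdos_gyarfas _ _ _.
have c0 : 0 < 'C(t, 2) by rewrite bin_gt0 ltnW.
have cp : 0 < 'C(2 * (t + 'C(t, 2)), 2) by rewrite bin_gt0; lia.
have qle : q <= 'C(2 * (t + 'C(t, 2)), 2) by rewrite /q; lia.
have [c pqc <-] : pq_colorable_with n (2 * (t + 'C(t, 2))) q eg by apply: erdos_gyarfasP.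
have rich (A : {set 'I_n}) : #|A| = 2 * (t + 'C(t, 2)) ->
    'C(2 * (t + 'C(t, 2)), 2) < ncolors c A + 2 * 'C(t, 2).
  by move/pqc; rewrite /q; lia.
have := @color_turan_energy _ c t rich; rewrite card_ord (ltnW t2).
rewrite (_ : 4160 * _ = 2080 * (2 * 'C(t, 2))); last by ring.
apply=> //; have := @turan_subdivided_clique_ge (n ^ 2) t t2.
have : 2 <= n ^ 2 by nia.
lia.
Qed.

(** * Asymptotics *)

From mathcomp Require Import classical_sets reals topology normedtype.
From mathcomp Require Import landau sequences exp.
Import numFieldNormedType.Exports.

Lemma bipartite_subdivided_clique t : bipartite (subdivided_clique t).
Proof.
exists [set v : subdivided_clique t | if v is inl _ then true else false].
move=> _ /imsetP[[i e] _ ->]; apply/eqP/cards1P; exists (inl i).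
apply/finset.setP => -[j|e']; rewrite !inE ?orbF ?andbT //=.
by rewrite andbF.
Qed.

Lemma turan_subdivided_clique n k : 0 < k ->
  turan n (subdivided_clique k.+2) ^ k.*2.+1 <=
    4 ^ k.*2.+1 * (64 * k.+2 * 'C(k.+2, 2)) ^ k.+3.*2 * n ^ (3 * k).+1.
Proof.
move=> k0; apply: (big_ind (fun x => x ^ k.*2.+1 <= _)).
- by rewrite exp0n.
- by move=> a b ha hb; rewrite /maxn; case: ifP.
- by move=> E /andP[Esub Efree]; apply: card_subdivision_free.
Qed.

Local Open Scope ring_scope.
Local Open Scope classical_set_scope.

Lemma turan_subdivided_clique_bigO (R : realType) t : (2 < t)%N ->
  turan_bigO (subdivided_clique t) (1 / 2 + 1 / (4 * t%:R - 6) : R).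
Proof.
case: t => [|[|k]] // k0; apply/eqO_exP.
set M := (4 ^ k.*2.+1 * (64 * k.+2 * 'C(k.+2, 2)) ^ k.+3.*2)%N.
have G0 : (0 < 64 * k.+2 * 'C(k.+2, 2))%N by rewrite !muln_gt0 bin_gt0.
have M0 : (0 < M)%N by rewrite /M (muln_gt0 (4 ^ _)) !expn_gt0 G0.
exists M%:R; first by rewrite ltr0n.
near=> n.
rewrite !ger0_norm ?powR_ge0 //.
(* The exponent [b] is [(3k+1) / (2k+1)], so both sides are compared after raising to the power
   [2k + 1]; [M <= M ^ (2k+1)] avoids taking a root of [M]. *)
set b : R := 2 - _; have bE : b * k.*2.+1%:R = (3 * k).+1%:R.
  rewrite (_ : k.*2.+1%:R = 2 * k%:R + 1); last by rewrite -natr1 -mul2n natrM.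
  rewrite (_ : (3 * k).+1%:R = 3 * k%:R + 1); last by rewrite -natr1 natrM.
  rewrite /b (_ : k.+2%:R = k%:R + 2); last by rewrite -natrD addn2.
  by field; have : (0 <= k%:R :> R) by []; lra.
rewrite -(@ler_pXn2r _ k.*2.+1) ?nnegrE ?mulr_ge0 ?powR_ge0 // exprMn.
rewrite -(powR_mulrn k.*2.+1 (powR_ge0 _ _)) -powRrM bE powR_mulrn // -!natrX -natrM ler_nat.
apply: leq_trans (turan_subdivided_clique n _) _; first by lia.
by rewrite -/M leq_mul2r; apply/orP; right; rewrite -{1}[M]expn1 leq_pexp2l.
Unshelve. all: by end_near. Qed.

Lemma erdos_gyarfas_subdivided_clique_Omega (R : realType) t (a : R) : (2 < t)%N ->
  turan_bigO (subdivided_clique t) a ->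
  (fun n : nat =>
     (erdos_gyarfas n (2 * #|subdivided_clique t|)
        ('C(2 * #|subdivided_clique t|, 2) - #|edges (subdivided_clique t)| + 1))%:R : R)
  =Omega_\oo (fun n : nat => n%:R `^ (2 * a)).
Proof.
move=> t2 /eqO_exP[K K0 [N _ turanK]]; rewrite eqOmegaE eqOmegaO; apply/eqO_exP.
have c0 : (0 < 'C(t, 2))%N by rewrite bin_gt0 ltnW.
exists ((4160 * 'C(t, 2))%:R * K); first by rewrite mulr_gt0 // ltr0n muln_gt0.
near=> n.
rewrite !ger0_norm ?powR_ge0 //.
have n0 : (0 < n%:R :> R) by rewrite ltr0n; near: n; exact: nbhs_infty_gt.
have Nn : (N <= n ^ 2)%N.
  apply: (@leq_trans n); first by near: n; exact: nbhs_infty_ge.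
  by rewrite -mulnn leq_pmulr // -(ltr0n R).
have sn : (2 * #|subdivided_clique t| <= n)%N by near: n; exact: nbhs_infty_ge.
have := erdos_gyarfas_turan t2 sn; set eg := erdos_gyarfas _ _ _; set tau := turan _ _.
rewrite -(ler_nat R) => core.
have := turanK _ Nn; rewrite /= !ger0_norm ?powR_ge0 // -/tau => tauK.
(* The Turán bound on [n ^ 2] vertices has order [n^(4 - 2a)], so dividing [n ^ 4] by it leaves
   [n^(2a)]. *)
have powE : (n ^ 2)%:R `^ (2 - a) * n%:R `^ (2 * a) = (n ^ 4)%:R :> R.
  rewrite natrX -(powR_mulrn 2 (ltW n0)) -powRrM -powRD; last by rewrite (gt_eqF n0) implybT.
  rewrite (_ : 2%:R * (2 - a) + 2 * a = 4%:R); last by ring.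
  by rewrite powR_mulrn ?ltW // natrX.
have P0 : 0 < (n ^ 2)%:R `^ (2 - a) :> R by rewrite powR_gt0 // natrX exprn_gt0.
rewrite -(ler_pM2l P0) powE; apply: le_trans core _.
rewrite (natrM _ (4160 * 'C(t, 2))) (natrM _ eg).
rewrite (_ : _ * (_ * K * _) = (4160 * 'C(t, 2))%:R *
  (eg%:R * (K * (n ^ 2)%:R `^ (2 - a)))); last by ring.
by apply: ler_wpM2l => //; apply: ler_wpM2l.
Unshelve. all: by end_near. Qed.

Theorem theorem2p5 (R : realType) (t : nat) (ht : (3 <= t)%N) :
  nice R 2 (subdivided_clique t) /\
  let s := #|subdivided_clique t| in
  [/\ s = (t + 'C(t, 2))%N,
      #|edges (subdivided_clique t)| = (2 * 'C(t, 2))%N &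
      (fun n : nat =>
         (erdos_gyarfas n (2 * s) ('C(2 * s, 2) - 2 * 'C(t, 2) + 1))%:R : R)
      =Omega_\oo (fun n : nat => n%:R `^ (1 + 1 / (2 * t%:R - 3)))].
Proof.
split.
  split=> // [|a a0 turana]; first exact: bipartite_subdivided_clique.
  split=> //; first exact: bipartite_subdivided_clique.
  rewrite (_ : a * 2%:R / (2%:R - 1) = 2 * a); last by field.
  rewrite subn1 mul1n; exact: erdos_gyarfas_subdivided_clique_Omega.
split; [exact: card_subdivided_clique|exact: card_subdivided_clique_edges|].
rewrite -card_subdivided_clique_edges.
have -> : 1 + 1 / (2 * t%:R - 3) = 2 * (1 / 2 + 1 / (4 * t%:R - 6)) :> R.
  have : (3%:R <= t%:R :> R) by rewrite ler_nat.
  move=> t3; field; apply/andP; split; lra.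
apply: erdos_gyarfas_subdivided_clique_Omega => //.
exact: turan_subdivided_clique_bigO.
Qed.
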